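(* Let $n\ge 4$ be fixed and let $p\wedge q\to\infty$. Suppose that there are constants $a,b,a',b'$ not depending on $p,q$ with $0<a\le\inf_i \mathrm{var}(x_i)\le\sup_iE(x_i^2)\le b<\infty$ and $0<a'\le\inf_j \mathrm{var}(y_j)\le\sup_jE(y_j^2)\le b'<\infty$. (i) One has $$dCov_n^2(\mathbf X,\mathbf Y)=\frac1\tau\sum_{i=1}^p\sum_{j=1}^q \mathrm{cov}_n^2(\mathcal X_i,\mathcal Y_j)+\mathcal R_n .$$ Here $$\mathrm{cov}_n^2(\mathcal X_i,\mathcal Y_j)=\frac{1}{\binom n4}\sum_{s<t<u<v}h(x_{si},x_{ti},x_{ui},x_{vi};y_{sj},y_{tj},y_{uj},y_{vj}),$$ and the kernel $h$ is defined as $$h(x_{si},x_{ti},x_{ui},x_{vi};y_{sj},y_{tj},y_{uj},y_{vj})=\frac1{4!}\sum_{*}^{(s,t,u,v)}\frac14(x_{si}-x_{ti})(y_{sj}-y_{tj})(x_{ui}-x_{vi})(y_{uj}-y_{vj}),$$ where the summation $\sum_*^{(s,t,u,v)}$ is over all permutations of the 4-tuple of indices $(s,t,u,v)$, and $\mathcal R_n$ is the remainder term. $\mathrm{cov}_n^2(\mathcal X_i,\mathcal Y_j)$ is a fourth-order U-statistic and is an unbiased estimator of the squared covariance between $x_i$ and $y_j$, i.e. $E[\mathrm{cov}_n^2(\mathcal X_i,\mathcal Y_j)]=\mathrm{cov}^2(x_i,y_j)$. (ii) Suppose further that $L_X(X,X')=O_p(a_p)$ and $L_Y(Y,Y')=O_p(b_q)$,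 where $a_p,b_q$ are sequences of numbers with $a_p=o(1)$, $b_q=o(1)$, $\tau_X^2a_p^3=o(1)$, $\tau_Y^2b_q^3=o(1)$, $\tau a_p^2b_q=o(1)$, $\tau a_pb_q^2=o(1)$. Then $$\frac1\tau\sum_{i=1}^p\sum_{j=1}^q \mathrm{cov}_n^2(\mathcal X_i,\mathcal Y_j)=O_p(\tau a_pb_q),\qquad \mathcal R_n=O_p(\tau a_p^2b_q+\tau a_pb_q^2)=o_p(1);$$ thus the remainder term is of smaller order compared to the leading term and therefore is asymptotically negligible.
   Context: Setting. For each $p,q$, $(X,Y)$ is a pair of random vectors $X=(x_1,\dots,x_p)^T\in\mathbb R^p$, $Y=(y_1,\dots,y_q)^T\in\mathbb R^q$. $(X_1,Y_1),\dots,(X_n,Y_n)$ are i.i.d. copies of $(X,Y)$, with $X_s=(x_{s1},\dots,x_{sp})^T$, $Y_s=(y_{s1},\dots,y_{sq})^T$. $\mathbf X=(X_1,\dots,X_n)^T$, $\mathbf Y=(Y_1,\dots,Y_n)^T$ are the sample matrices; $\mathcal X_i=(x_{1i},\dots,x_{ni})^T$ and $\mathcal Y_j=(y_{1j},\dots,y_{nj})^T$ are the componentwise samples. $|\cdot|$ is the Euclidean norm; $(X',Y')$ is an independent copy of $(X,Y)$. $\mathcal U$-centering. For any matrix $\mathbf A=(a_{st})\in\mathbb R^{n\times n}$, $\widetilde{\mathbf A}=(\tilde a_{st})$ is defined by $\tilde a_{ss}=0$ and, for $s\neq t$, $\tilde a_{st}=a_{st}-\frac1{n-2}\sum_{v=1}^n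 a_{sv}-\frac1{n-2}\sum_{u=1}^n a_{ut}+\frac1{(n-1)(n-2)}\sum_{u,v=1}^n a_{uv}$. The inner product is $(\widetilde{\mathbf A}\cdot\widetilde{\mathbf B})=\frac1{n(n-3)}\sum_{s\ne t}\tilde a_{st}\tilde b_{st}$. Sample distance covariance: $dCov_n^2(\mathbf X,\mathbf Y)=(\widetilde{\mathbf A}\cdot\widetilde{\mathbf B})$ with $a_{st}=|X_s-X_t|$, $b_{st}=|Y_s-Y_t|$ for $s,t=1,\dots,n$. Notation: $\tau_X^2=E|X-X'|^2$, $\tau_Y^2=E|Y-Y'|^2$, $\tau=\tau_X\tau_Y$ (positive roots); $L_X(X,X')=\frac{|X-X'|^2-\tau_X^2}{\tau_X^2}$, $L_Y(Y,Y')=\frac{|Y-Y'|^2-\tau_Y^2}{\tau_Y^2}$. *)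

(* Defs.v *)
From HB Require Import structures.
From mathcomp Require Import all_boot all_order all_algebra perm.
From mathcomp Require Import all_classical all_reals all_analysis.

Set Implicit Arguments.
Unset Strict Implicit.
Unset Printing Implicit Defensive.

Import Order.TTheory GRing.Theory Num.Theory.
Import numFieldNormedType.Exports.

Local Open Scope classical_set_scope.
Local Open Scope ring_scope.

(* Random vectors are random variables with values in m.-tuple R, which carries
   the product sigma-algebra of the Borel sets of R. *)

(* The library's norm on row vectors is the sup norm, hence this definition. *)
Definition edist {R : realType} {m : nat} (u v : m.-tuple R) : R :=
  Num.sqrt (\sum_(i < m) (tnth u i - tnth v i) ^+ 2).

Section sample_statistics.
Context {R : realType} {n : nat}.

Definition Ucenter (A : 'M[R]_n) : 'M[R]_n :=
  \matrix_(s, t)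
    if s == t then 0 else
      A s t - (n%:R - 2)^-1 * (\sum_(v < n) A s v)
            - (n%:R - 2)^-1 * (\sum_(u < n) A u t)
            + ((n%:R - 1) * (n%:R - 2))^-1 * (\sum_(u < n) \sum_(v < n) A u v).

(* To be applied to U-centered matrices. *)
Definition Uinner (A B : 'M[R]_n) : R :=
  (n%:R * (n%:R - 3))^-1 * \sum_(s < n) \sum_(t < n | s != t) A s t * B s t.

Definition distmx {m : nat} (X : 'I_n -> m.-tuple R) : 'M[R]_n :=
  \matrix_(s, t) edist (X s) (X t).

Definition dCov2 {p q : nat} (X : 'I_n -> p.-tuple R) (Y : 'I_n -> q.-tuple R)
  : R := Uinner (Ucenter (distmx X)) (Ucenter (distmx Y)).

Definition cov_kernel (x y : 4.-tuple R) : R :=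
  (4`!)%:R^-1 * \sum_(g : 'S_4)
    let x_ (k : nat) := tnth x (g (inord k)) in
    let y_ (k : nat) := tnth y (g (inord k)) in
    4^-1 * (x_ 0%N - x_ 1%N) * (y_ 0%N - y_ 1%N)
         * (x_ 2%N - x_ 3%N) * (y_ 2%N - y_ 3%N).

Definition cov2 (x y : 'I_n -> R) : R :=
  ('C(n, 4))%:R^-1 *
  \sum_(s < n) \sum_(t < n | (s < t)%N)
    \sum_(u < n | (t < u)%N) \sum_(v < n | (u < v)%N)
      cov_kernel [tuple x s; x t; x u; x v] [tuple y s; y t; y u; y v].

End sample_statistics.

Section copies.
Context {d d' : measure_display} {T : measurableType d} {T' : measurableType d'}
  {R : realType} (P : probability T R).

Definition same_law (Z Z' : T -> T') : Prop :=
  forall A, measurable A -> P (Z @^-1` A) = P (Z' @^-1` A).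

(* Some A i may be the full set, so this covers all subfamilies. *)
Definition mutually_independent {I : finType} (Z : I -> T -> T') : Prop :=
  forall A : I -> set T', (forall i, measurable (A i)) ->
    P (\bigcap_(i in [set: I]) (Z i @^-1` A i)) =
    (\prod_(i : I) P (Z i @^-1` A i))%E.

Definition iid_copies {I : finType} (Z0 : T -> T') (Z : I -> T -> T') : Prop :=
  mutually_independent Z /\ forall i, same_law (Z i) Z0.

Definition independent_copy (Z Z' : T -> T') : Prop :=
  same_law Z' Z /\
  forall A B, measurable A -> measurable B ->
    P (Z @^-1` A `&` Z' @^-1` B) = (P (Z @^-1` A) * P (Z' @^-1` B))%E.

End copies.

Section population.
Context {d : measure_display} {T : measurableType d} {R : realType}
  (P : probability T R) {m : nat}.

(* tau_X, where U' is meant to be an independent copy of U. *)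
Definition tau_of (U U' : T -> m.-tuple R) : R :=
  Num.sqrt (fine 'E_P[fun w => edist (U w) (U' w) ^+ 2]).

Definition L_of (U U' : T -> m.-tuple R) (w : T) : R :=
  (edist (U w) (U' w) ^+ 2 - tau_of U U' ^+ 2) / tau_of U U' ^+ 2.

End population.

(* Asymptotics of doubly indexed families as min(p, q) tends to infinity, that
   is, along the product filter of \oo with itself. Each member of a family of
   random variables may live on its own probability space. *)
Section asymptotics.
Context {R : realType} {d : nat -> nat -> measure_display}
  {T : forall p q, measurableType (d p q)}
  (P : forall p q, probability (T p q) R).

Definition is_o1 (f : nat -> nat -> R) : Prop :=
  (fun k => f k.1 k.2) @ filter_prod \oo \oo --> (0 : R).

Definition is_Op (Z : forall p q, T p q -> R) (r : nat -> nat -> R) : Prop :=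
  forall e : R, 0 < e -> exists2 M : R, 0 < M &
    \forall p \near \oo & q \near \oo,
      (P p q [set w | (M * `|r p q| < `|Z p q w|)%R] <= e%:E)%E.

Definition is_op (Z : forall p q, T p q -> R) (r : nat -> nat -> R) : Prop :=
  forall e : R, 0 < e ->
    (fun k => P k.1 k.2 [set w | e * `|r k.1 k.2| < `|Z k.1 k.2 w|])
      @ filter_prod \oo \oo --> 0%E.

End asymptotics.

(* Main.v *)
Require Import Defs.
From HB Require Import structures.
From mathcomp Require Import all_boot all_order all_algebra perm.
From mathcomp Require Import all_classical all_reals all_analysis.
From mathcomp Require Import measurable_realfun ring lra.
Import Order.TTheory GRing.Theory Num.Theory.
Import numFieldNormedType.Exports.
Local Open Scope classical_set_scope.
Local Open Scope ring_scope.

(* Off the diagonal |X_s - X_t| = tau_X (1 + L/2 + T), where L is the relative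
   deviation of |X_s - X_t|^2 from tau_X^2 and |T| <= L^2. U-centering is linear
   and kills the matrix of ones off the diagonal, so dCov_n^2 is the bilinear
   expression tau <L_X/2 + T_X, L_Y/2 + T_Y>. Its part tau/4 <L_X, L_Y> is the
   U-centered inner product of the squared distance matrices divided by 4 tau;
   splitting these over coordinates leaves one-dimensional inner products, which
   are the statistics cov_n^2(X_i, Y_j) by an algebraic identity between
   sums over four distinct indices. The other three terms form R_n. As n is fixed
   and (X_s, X_t) has the law of (X, X'), a union bound turns the assumptions on
   L_X and L_Y into uniform bounds on the entries of these matrices. *)

(** * Sums over distinct indices *)

(** The expansion of the distance is an exact identity, and since the ratio |X_s - X_t| / tau_X is
    nonnegative, the bound on T holds whatever the size of L: no event where L is small has to be
    split off. The analytic estimates are thus deterministic, with a constant depending on n alone,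
    which matters because the probability space changes with p and q. Probability enters only
    through one exceptional event for each p, q, outside of which lead and remainder are bounded
    together. The inner product of T_X and T_Y has order tau a_p^2 b_q^2, which is not among the
    announced rates; it is absorbed by tau a_p^2 b_q because |b_q| < 1 eventually. For unbiasedness
    the obstacle is to make two pairs of observations independent of each other when independence is
    given only for events on single observations; uniqueness of measures on rectangles bridges
    this. *)

Definition permute_tuple {A : Type} {k : nat} (g : 'S_k) (z : k.-tuple A) : k.-tuple A :=
  [tuple tnth z (g i) | i < k].

Lemma permute_tupleK {A : Type} {k : nat} (g : 'S_k) :
  cancel (@permute_tuple A k g) (@permute_tuple A k g^-1%g).
Proof. by move=> z; apply: eq_from_tnth => i; rewrite !tnth_mktuple permKV. Qed.

Lemma permute_tupleKV {A : Type} {k : nat} (g : 'S_k) :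
  cancel (@permute_tuple A k g^-1%g) (@permute_tuple A k g).
Proof. by move=> z; apply: eq_from_tnth => i; rewrite !tnth_mktuple permK. Qed.

Lemma uniq_permute_tuple {A : eqType} {k : nat} (g : 'S_k) (z : k.-tuple A) :
  uniq (permute_tuple g z) = uniq z.
Proof.
apply: perm_uniq.
by apply/tuple_permP; exists g.
Qed.

Lemma sum_permute_tuple {A : finType} {V : nmodType} {k : nat} (g : 'S_k)
    (P : pred (k.-tuple A)) (F : k.-tuple A -> V) :
  \sum_(z | P z) F (permute_tuple g z) =
  \sum_(z | P (permute_tuple g^-1%g z)) F z.
Proof.
rewrite [RHS](reindex_onto (permute_tuple g) (permute_tuple g^-1%g)) /=.
  apply: eq_bigl => z; rewrite permute_tupleK eqxx andbT //.
by move=> z _; exact: permute_tupleKV.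
Qed.

Lemma sum_uniq_permute_tuple {A : finType} {V : nmodType} {k : nat} (g : 'S_k)
    (F : k.-tuple A -> V) :
  \sum_(z : k.-tuple A | uniq z) F (permute_tuple g z) =
  \sum_(z : k.-tuple A | uniq z) F z.
Proof.
rewrite sum_permute_tuple.
by apply: eq_bigl => z; rewrite uniq_permute_tuple.
Qed.

Definition ord_sorted {n : nat} (s : seq 'I_n) := sorted (relpre val ltn) s.

(** The boolean [uniq z] is read as 1 or 0. A strictly sorted rearrangement excludes repetitions;
    for distinct entries it exists by sorting, and it determines the permutation because [tnth z] is
    injective. *)
Lemma card_sorted_permute {n k : nat} (z : k.-tuple 'I_n) :
  #|[pred g : 'S_k | ord_sorted (permute_tuple g z)]| = uniq z.
Proof.
have tr : transitive (relpre (@nat_of_ord n) ltn).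
  by move=> x y t; exact: ltn_trans.
have [uz|nuz] /= := boolP (uniq z); last first.
  apply: eq_card0 => g; rewrite !inE; apply/negP => sg; case/negP: nuz.
  rewrite -(uniq_permute_tuple g).
  by apply: sorted_uniq sg => // x; rewrite /= ltnn.
have : perm_eq (sort (relpre (@nat_of_ord n) leq) z) z by rewrite perm_sort.
case/tuple_permP => g eg.
have sg : ord_sorted (permute_tuple g z).
  rewrite /ord_sorted /= -eg.
  (* [sort] only yields weak monotonicity. Strict order is weak order plus inequality, so pairwise
     sortedness splits into [uniq] and [sort_sorted]. *)
  rewrite (@eq_sorted _ _ [rel x y | (x != y) && relpre (@nat_of_ord n) leq x y]); last first.
    by move=> x y; rewrite /= ltn_neqAle.
  have uz' : uniq (sort (relpre (@nat_of_ord n) leq) z) by rewrite sort_uniq.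
  rewrite sorted_pairwise; last first.
    move=> y x t /andP[nxy lxy] /andP[_ lyt] /=; rewrite (leq_trans lxy lyt) andbT.
    apply: contra_neq nxy => xt; apply/val_inj/anti_leq/andP; split=> //.
    by rewrite xt.
  rewrite pairwise_relI -uniq_pairwise uz' /= -sorted_pairwise.
    by apply: sort_sorted => x y; exact: leq_total.
  by move=> y x t; exact: leq_trans.
apply/eqP/card1P; exists g => g'; rewrite !inE; apply/idP/eqP => [sg'|-> //].
have e : permute_tuple g' z = permute_tuple g z.
  apply/val_inj/(irr_sorted_eq tr) => //; first by move=> x /=; rewrite ltnn.
  by apply: perm_mem; apply: (@perm_trans _ z); [|rewrite perm_sym]; apply/tuple_permP; eexists.
apply/permP => i; have /(congr1 (fun t => tnth t i)) := e.
by rewrite !tnth_mktuple => /(tuple_uniqP _ uz).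
Qed.

(** After exchanging the sums, each tuple is counted once for every permutation that sorts it, a
    number given by [card_sorted_permute]. *)
Lemma sum_ord_sorted {V : nmodType} {n k : nat} (F : k.-tuple 'I_n -> V) :
  \sum_(z : k.-tuple 'I_n | ord_sorted z) \sum_(g : 'S_k) F (permute_tuple g z) =
  \sum_(z : k.-tuple 'I_n | uniq z) F z.
Proof.
rewrite exchange_big /=.
under eq_bigr do rewrite sum_permute_tuple.
rewrite (reindex_inj (@invg_inj {perm 'I_k})) /= (exchange_big_dep xpredT) //= [RHS]big_mkcond /=.
apply: eq_bigr => z _.
under eq_bigl do rewrite invgK.
by rewrite sumr_const card_sorted_permute; case: uniq.
Qed.

Lemma sum_tuple_cons {A : finType} {V : nmodType} {k : nat} (F : k.+1.-tuple A -> V) :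
  \sum_z F z = \sum_x \sum_(z : k.-tuple A) F [tuple of x :: z].
Proof.
rewrite pair_big /= (reindex (fun xz : A * k.-tuple A => [tuple of xz.1 :: xz.2])) //=.
exists (fun z => (thead z, [tuple of behead z])) => [[x z]|z] _ /=.
  by congr pair; exact: val_inj.
by rewrite -tuple_eta.
Qed.

Lemma sum_tuple4 {A : finType} {V : nmodType} (F : 4.-tuple A -> V) :
  \sum_z F z = \sum_s \sum_t \sum_u \sum_v F [tuple s; t; u; v].
Proof.
rewrite sum_tuple_cons; apply: eq_bigr => s _.
rewrite sum_tuple_cons; apply: eq_bigr => t _.
rewrite sum_tuple_cons; apply: eq_bigr => u _.
rewrite sum_tuple_cons; apply: eq_bigr => v _.
rewrite (big_pred1 [tuple]) => [|z]; last by apply/esym/eqP/val_inj; case: z => -[].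
by congr F; exact: val_inj.
Qed.

Local Notation o4_0 := (@Ordinal 4 0 isT).
Local Notation o4_1 := (@Ordinal 4 1 isT).
Local Notation o4_2 := (@Ordinal 4 2 isT).
Local Notation o4_3 := (@Ordinal 4 3 isT).

(** Summing over [uniq] tuples, rather than over four nested indices, lets the symmetric group act
    by reindexing; the nested form, suited to evaluation, is [sum_distinct4E]. *)
Definition sum_distinct4 {A : finType} {V : nmodType} (F : A -> A -> A -> A -> V) : V :=
  \sum_(z : 4.-tuple A | uniq z) F (tnth z o4_0) (tnth z o4_1) (tnth z o4_2) (tnth z o4_3).

Lemma sum_distinct4E {A : finType} {V : nmodType} (F : A -> A -> A -> A -> V) :
  sum_distinct4 F =
  \sum_s \sum_(t | t != s) \sum_(u | (u != s) && (u != t))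
    \sum_(v | [&& v != s, v != t & v != u]) F s t u v.
Proof.
have uE (s t u v : A) : uniq [tuple s; t; u; v] =
    [&& t != s, (u != s) && (u != t) & [&& v != s, v != t & v != u]].
  rewrite /= !inE !negb_or [s == t]eq_sym [s == u]eq_sym [t == u]eq_sym ![_ == v]eq_sym.
  by case: (t != s); case: (u != s); case: (u != t); case: (v != s);
    case: (v != t); case: (v != u).
rewrite /sum_distinct4 big_mkcond sum_tuple4; apply: eq_bigr => s _.
under eq_bigr do under eq_bigr do under eq_bigr do rewrite uE.
rewrite [RHS]big_mkcond /=; apply: eq_bigr => t _.
case: (t != s) => /=; last by rewrite big1 // => u _; rewrite big1.
rewrite [RHS]big_mkcond /=; apply: eq_bigr => u _.
case: (_ && _) => /=; last by rewrite big1.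
by rewrite [RHS]big_mkcond.
Qed.

(** Renaming of the summation variables: the positions i, j, k, l form a permutation of the four
    slots. *)
Lemma sum_distinct4_perm {A : finType} {V : nmodType} (F : A -> A -> A -> A -> V)
    (i j k l : 'I_4) : uniq [:: i; j; k; l] ->
  \sum_(z : 4.-tuple A | uniq z) F (tnth z i) (tnth z j) (tnth z k) (tnth z l) =
  sum_distinct4 F.
Proof.
move=> uijkl.
have inj : injective (tnth [tuple i; j; k; l]) by apply/tuple_uniqP.
have := sum_uniq_permute_tuple (perm inj)
  (fun z => F (tnth z o4_0) (tnth z o4_1) (tnth z o4_2) (tnth z o4_3)).
rewrite /sum_distinct4 => /= <-.
by apply: eq_bigr => z _; rewrite !tnth_mktuple !permE.
Qed.

Section sum_neq.
Context {A : finType} {V : zmodType} (f : A -> V).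

Lemma sum_neq1 s : \sum_(t | t != s) f t = \sum_t f t - f s.
Proof. by rewrite [in RHS](bigD1 s) //= [RHS]addrC addKr. Qed.

Lemma sum_neq2 s t : t != s ->
  \sum_(u | (u != s) && (u != t)) f u = \sum_u f u - f s - f t.
Proof.
by move=> ts; rewrite -sum_neq1 [in RHS](bigD1 t) //= [RHS]addrC addKr.
Qed.

Lemma sum_neq3 s t u : t != s -> u != s -> u != t ->
  \sum_(v | [&& v != s, v != t & v != u]) f v = \sum_v f v - f s - f t - f u.
Proof.
move=> ts us ut; rewrite -sum_neq2 // [in RHS](bigD1 u) /=; last by rewrite us.
rewrite [RHS]addrC addKr.
by apply: eq_bigl => v; rewrite andbA.
Qed.

End sum_neq.

Section sums_of_products.
Context {R : comNzRingType} {n : nat} (D E : 'I_n -> 'I_n -> R).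
Context (Ds : forall s t, D s t = D t s) (D0 : forall s, D s s = 0).
Context (Es : forall s t, E s t = E t s) (E0 : forall s, E s s = 0).

(** These three sums suffice to evaluate any sum over distinct quadruples of one entry of D times
    one entry of E. The index pairs are disjoint, share one index or coincide, and excluding
    coincidences always leads back to [a], [c] and [m]. *)
Let a := \sum_s \sum_t D s t * E s t.
Let c := \sum_s (\sum_t D s t) * (\sum_t E s t).
Let m := (\sum_s \sum_t D s t) * (\sum_s \sum_t E s t).

Lemma sum_distinct4_disjoint :
  sum_distinct4 (fun s t u v => D s t * E u v) = m - 4 * c + 2 * a.
Proof.
rewrite sum_distinct4E.
pose r s := \sum_t E s t.
transitivity (\sum_s \sum_t (D s t * (\sum_s r s) - 2 * (D s t * r s) - 2 * (D s t * r t)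
   + 2 * (D s t * E s t))).
  apply: eq_bigr => s _.
  rewrite [RHS](bigD1 s) //= D0 !mul0r !mulr0 !subr0 !addr0 add0r.
  apply: eq_bigr => t ts.
  transitivity (D s t * \sum_(u | (u != s) && (u != t)) (r u - E s u - E t u)).
    rewrite mulr_sumr; apply: eq_bigr => u /andP[us ut].
    by rewrite -mulr_sumr sum_neq3 // E0 subr0 (Es u s) (Es u t).
  rewrite sum_neq2 // !sumrB !E0 (Es t s) -/(r s) -/(r t); ring.
have cE : \sum_s \sum_t D s t * r s = c.
  by apply: eq_bigr => s _; rewrite mulr_suml.
have cE' : \sum_s \sum_t D s t * r t = c.
  by rewrite exchange_big /= -cE; apply: eq_bigr => s _; apply: eq_bigr => t _; rewrite Ds.
have mE : \sum_s \sum_t D s t * (\sum_s r s) = m.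
  by rewrite /m mulr_suml; apply: eq_bigr => s _; rewrite mulr_suml.
under eq_bigr do rewrite big_split /= !sumrB -!mulr_sumr.
rewrite big_split /= !sumrB -!mulr_sumr cE cE' mE -/a; ring.
Qed.

Lemma sum_distinct4_same :
  sum_distinct4 (fun s t u v => D s t * E s t) = (n%:R - 2) * (n%:R - 3) * a.
Proof.
rewrite sum_distinct4E /a mulr_sumr; apply: eq_bigr => s _.
rewrite mulr_sumr [RHS](bigD1 s) //= D0 mul0r mulr0 add0r.
apply: eq_bigr => t ts.
transitivity (\sum_(u | (u != s) && (u != t)) (n%:R - 3) * (D s t * E s t)).
  apply: eq_bigr => u /andP[us ut].
  by rewrite sum_neq3 // sumr_const card_ord -mulr_natl; ring.
rewrite sum_neq2 // sumr_const card_ord -mulr_natl; ring.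
Qed.

Lemma sum_distinct4_adjacent :
  sum_distinct4 (fun s t u v => D s t * E s u) = (n%:R - 3) * (c - a).
Proof.
rewrite sum_distinct4E /c /a -sumrB mulr_sumr; apply: eq_bigr => s _.
rewrite mulr_suml -sumrB mulr_sumr [RHS](bigD1 s) //= D0 !mul0r subr0 mulr0 add0r.
apply: eq_bigr => t ts.
transitivity (\sum_(u | (u != s) && (u != t)) (n%:R - 3) * (D s t * E s u)).
  apply: eq_bigr => u /andP[us ut].
  by rewrite sum_neq3 // sumr_const card_ord -mulr_natl; ring.
rewrite -!mulr_sumr sum_neq2 // E0; ring.
Qed.

End sums_of_products.

(** Averaging the kernel over permutations and summing over increasing quadruples amounts to summing
    the bare kernel over all distinct quadruples; the constants combine as ['C(n, 4)] times 4!
    equals [n ^_ 4]. *)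
Lemma cov2E {R : realType} {n : nat} (x y : 'I_n -> R) :
  cov2 x y = (n ^_ 4)%:R^-1 * sum_distinct4 (fun s t u v =>
    4^-1 * (x s - x t) * (y s - y t) * (x u - x v) * (y u - y v)).
Proof.
pose F (z : 4.-tuple 'I_n) : R :=
  let f s t u v := 4^-1 * (x s - x t) * (y s - y t) * (x u - x v) * (y u - y v) in
  f (tnth z o4_0) (tnth z o4_1) (tnth z o4_2) (tnth z o4_3).
rewrite /sum_distinct4 -[X in _ = _ * X]/(\sum_(z : 4.-tuple 'I_n | uniq z) F z).
rewrite -sum_ord_sorted -bin_ffact natrM invfM -mulrA /cov2; congr (_ * _).
rewrite mulr_sumr [RHS]big_mkcond sum_tuple4 /=.
apply: eq_bigr => s _; rewrite big_mkcond; apply: eq_bigr => t _.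
rewrite /ord_sorted /=; case: (s < t)%N => /=; last first.
  by rewrite big1 // => u _; rewrite big1.
rewrite big_mkcond; apply: eq_bigr => u _; case: (t < u)%N => /=; last by rewrite big1.
rewrite big_mkcond; apply: eq_bigr => v _; case: (u < v)%N => //=.
rewrite /cov_kernel; congr (_ * _); apply: eq_bigr => g _.
have e (z : 'I_n -> R) (i : 'I_4) (k : nat) : k = i ->
  tnth [tuple z s; z t; z u; z v] (g (inord k)) = z (tnth (permute_tuple g [tuple s; t; u; v]) i).
  move=> ->; rewrite inord_val tnth_mktuple.
  by rewrite -(tnth_map z); congr tnth; exact: val_inj.
by rewrite /F /= !(e _ o4_0 0%N erefl, e _ o4_1 1%N erefl, e _ o4_2 2%N erefl, e _ o4_3 3%N erefl).
Qed.

(** * U-centered inner products *)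

Definition hollow {R : realType} {n : nat} (A : 'M[R]_n) := forall s, A s s = 0.
Definition symmetric_mx {R : realType} {n : nat} (A : 'M[R]_n) := forall s t, A s t = A t s.

(** U-centering acts like an orthogonal projection: once one factor is centered, centering the other
    changes nothing. *)
Lemma UinnerE {R : realType} {n : nat} (A B : 'M[R]_n) : (3 <= n)%N ->
  hollow A -> symmetric_mx A -> hollow B -> symmetric_mx B ->
  Uinner (Ucenter A) (Ucenter B) = (n%:R * (n%:R - 3))^-1 *
    (\sum_s \sum_t A s t * B s t
     - 2 / (n%:R - 2) * (\sum_s (\sum_t A s t) * (\sum_t B s t))
     + ((n%:R - 1) * (n%:R - 2))^-1 *
        ((\sum_s \sum_t A s t) * (\sum_s \sum_t B s t))).
Proof.
move=> n3 A0 As B0 Bs.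
have n2 : n%:R - 2 != 0 :> R by rewrite subr_eq0 eqr_nat; case: eqP n3 => // ->.
have n1 : n%:R - 1 != 0 :> R by rewrite subr_eq0 pnatr_eq1; case: eqP n3 => // ->.
rewrite /Uinner; congr (_ * _).
pose rA s := \sum_t A s t. pose rB s := \sum_t B s t.
pose mA := \sum_s rA s. pose mB := \sum_s rB s.
pose UA s t := A s t - (n%:R - 2)^-1 * rA s - (n%:R - 2)^-1 * rA t
  + ((n%:R - 1) * (n%:R - 2))^-1 * mA.
pose UB s t := B s t - (n%:R - 2)^-1 * rB s - (n%:R - 2)^-1 * rB t
  + ((n%:R - 1) * (n%:R - 2))^-1 * mB.
have cA t : \sum_u A u t = rA t by apply: eq_bigr => u _; rewrite As.
have cB t : \sum_u B u t = rB t by apply: eq_bigr => u _; rewrite Bs.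
(* The weights of the centering are those that make every off-diagonal row sum vanish. *)
have UAE s : \sum_(t | s != t) UA s t = 0.
  under eq_bigl do rewrite eq_sym.
  rewrite sum_neq1 /UA A0.
  rewrite big_split /= !sumrB !sumr_const card_ord -!mulr_sumr -/(rA s) -/mA.
  rewrite -!(mulr_natl (_ * _) n); field.
  by rewrite n1 n2.
have UAE' t : \sum_(s | s != t) UA s t = 0.
  rewrite -[RHS](UAE t); apply: eq_big => [s|s _]; first by rewrite eq_sym.
  by rewrite /UA As; ring.
transitivity (\sum_s \sum_(t | s != t) UA s t * UB s t).
  apply: eq_bigr => s _; apply: eq_bigr => t st.
  by rewrite !mxE (negbTE st) cA cB.
(* The centering terms of [UB] are constant along rows, along columns or globally, and so are
   annihilated by the vanishing row and column sums of [UA]. *)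
transitivity (\sum_s \sum_(t | s != t) UA s t * B s t).
  transitivity (\sum_s \sum_(t | s != t)
     (UA s t * B s t - (n%:R - 2)^-1 * rB s * UA s t - (n%:R - 2)^-1 * rB t * UA s t
      + ((n%:R - 1) * (n%:R - 2))^-1 * mB * UA s t)).
    by apply: eq_bigr => s _; apply: eq_bigr => t _; rewrite /UB; ring.
  under eq_bigr do rewrite big_split /= !sumrB -!mulr_sumr UAE !mulr0 subr0 addr0.
  rewrite sumrB; have -> : \sum_s \sum_(t | s != t) (n%:R - 2)^-1 * rB t * UA s t = 0.
    rewrite (exchange_big_dep xpredT) //= big1 // => t _.
    by rewrite -mulr_sumr UAE' mulr0.
  by rewrite subr0.
(* [UA] as a formula need not vanish on the diagonal, but [B] does, so the sum extends to all s,
   t. *)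
transitivity (\sum_s \sum_t (A s t * B s t - (n%:R - 2)^-1 * (rA s * B s t)
   - (n%:R - 2)^-1 * (rA t * B s t) + ((n%:R - 1) * (n%:R - 2))^-1 * mA * B s t)).
  apply: eq_bigr => s _; rewrite [RHS](bigD1 s) //= B0 !mulr0 !subr0 !addr0 add0r.
  under eq_bigl do rewrite eq_sym.
  by apply: eq_bigr => t _; rewrite /UA; ring.
under eq_bigr do rewrite big_split /= !sumrB -!mulr_sumr.
rewrite big_split /= !sumrB -!mulr_sumr -/rB -/mA -/mB.
have -> : \sum_s \sum_t rA t * B s t = \sum_s rA s * rB s.
  rewrite exchange_big /=; apply: eq_bigr => s _.
  by rewrite -mulr_sumr cB.
rewrite -/(rA _); field.
by rewrite n1 n2.
Qed.

Lemma cov2_Uinner {R : realType} {n : nat} (x y : 'I_n -> R) : (4 <= n)%N ->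
  cov2 x y = 4^-1 * Uinner (Ucenter (\matrix_(s, t) (x s - x t) ^+ 2))
                           (Ucenter (\matrix_(s, t) (y s - y t) ^+ 2)).
Proof.
move=> n4.
set A := \matrix_(s, t) (x s - x t) ^+ 2; set B := \matrix_(s, t) (y s - y t) ^+ 2.
have A0 s : A s s = 0 by rewrite mxE subrr expr0n.
have B0 s : B s s = 0 by rewrite mxE subrr expr0n.
have As s t : A s t = A t s by rewrite !mxE -opprB sqrrN.
have Bs s t : B s t = B t s by rewrite !mxE -opprB sqrrN.
have ne k : (k < 4)%N -> n%:R - k%:R != 0 :> R.
  by move=> k4; rewrite subr_eq0 eqr_nat gtn_eqF // (leq_trans k4).
have n1 : n%:R - 1 != 0 :> R := ne 1%N isT.
have n2 : n%:R - 2 != 0 :> R := ne 2%N isT.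
have n3 : n%:R - 3 != 0 :> R := ne 3%N isT.
have n0 : n%:R != 0 :> R by rewrite pnatr_eq0 -lt0n (leq_trans _ n4).
rewrite cov2E UinnerE //; last exact: ltnW.
have -> : (n ^_ 4)%:R = n%:R * (n%:R - 1) * (n%:R - 2) * (n%:R - 3) :> R.
  rewrite !ffactnSr ffactn0 mul1n !natrM subn0 !natrB //; exact: leq_trans n4.
(* Each polarization contributes 1/2 and the kernel 1/4, whence 1/16. Of the 16 products, 4 use the
   same index pair and 4 use disjoint pairs, both with sign +, while 8 share exactly one index and
   have sign -. *)
rewrite (_ : sum_distinct4 _ = 16^-1 * (
   4 * sum_distinct4 (fun s t u v => A s t * B s t)
   + 4 * sum_distinct4 (fun s t u v => A s t * B u v)
   - 8 * sum_distinct4 (fun s t u v => A s t * B s u))).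
  rewrite sum_distinct4_same // sum_distinct4_disjoint // sum_distinct4_adjacent //.
  field.
  by rewrite n0 n1 n2 n3.
(* Polarization: with D_st = (x_s - x_t)^2,
   2 (x_s - x_t) (x_u - x_v) = D_sv + D_tu - D_su - D_tv. *)
pose Q i j k l := \sum_(z : 4.-tuple 'I_n | uniq z)
  A (tnth z i) (tnth z j) * B (tnth z k) (tnth z l).
have Q1 i j k l : uniq [:: i; j; k; l] ->
    Q i j i j = sum_distinct4 (fun s t u v => A s t * B s t).
  by move=> u; rewrite -(@sum_distinct4_perm _ _ _ i j k l).
have Q2 i j k l : uniq [:: i; j; k; l] ->
    Q i j k l = sum_distinct4 (fun s t u v => A s t * B u v).
  by move=> u; rewrite -(@sum_distinct4_perm _ _ _ i j k l).
have Q3 i j k l : uniq [:: i; j; k; l] ->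
    Q i j i k = sum_distinct4 (fun s t u v => A s t * B s u).
  by move=> u; rewrite -(@sum_distinct4_perm _ _ _ i j k l).
transitivity (16^-1 * (
   (Q o4_0 o4_3 o4_0 o4_3 + Q o4_1 o4_2 o4_1 o4_2 + Q o4_0 o4_2 o4_0 o4_2 + Q o4_1 o4_3 o4_1 o4_3)
 + (Q o4_0 o4_3 o4_1 o4_2 + Q o4_1 o4_2 o4_0 o4_3 + Q o4_0 o4_2 o4_1 o4_3 + Q o4_1 o4_3 o4_0 o4_2)
 - (Q o4_0 o4_3 o4_0 o4_2 + Q o4_3 o4_0 o4_3 o4_1 + Q o4_2 o4_1 o4_2 o4_0 + Q o4_1 o4_2 o4_1 o4_3
    + Q o4_0 o4_2 o4_0 o4_3 + Q o4_2 o4_0 o4_2 o4_1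
    + Q o4_3 o4_1 o4_3 o4_0 + Q o4_1 o4_3 o4_1 o4_2))).
  rewrite /Q -!big_split /= -sumrB mulr_sumr; apply: eq_bigr => z _.
  by rewrite !mxE; field.
rewrite (Q1 o4_0 o4_3 o4_1 o4_2) // (Q1 o4_1 o4_2 o4_0 o4_3) //
  (Q1 o4_0 o4_2 o4_1 o4_3) // (Q1 o4_1 o4_3 o4_0 o4_2) //.
rewrite (Q2 o4_0 o4_3 o4_1 o4_2) // (Q2 o4_1 o4_2 o4_0 o4_3) //
  (Q2 o4_0 o4_2 o4_1 o4_3) // (Q2 o4_1 o4_3 o4_0 o4_2) //.
rewrite (Q3 o4_0 o4_3 o4_2 o4_1) // (Q3 o4_3 o4_0 o4_1 o4_2) //
  (Q3 o4_2 o4_1 o4_0 o4_3) // (Q3 o4_1 o4_2 o4_3 o4_0) //.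
rewrite (Q3 o4_0 o4_2 o4_3 o4_1) // (Q3 o4_2 o4_0 o4_1 o4_3) //
  (Q3 o4_3 o4_1 o4_0 o4_2) // (Q3 o4_1 o4_3 o4_2 o4_0) //.
by ring.
Qed.

Lemma ler_norm_sum_ord {R : numDomainType} {n : nat} (f : 'I_n -> R) (b : R) :
  (forall i, `|f i| <= b) -> `|\sum_i f i| <= n%:R * b.
Proof.
move=> fb; apply: (le_trans (ler_norm_sum _ _ _)).
apply: (le_trans (ler_sum _ (fun i _ => fb i))).
by rewrite sumr_const card_ord mulr_natl.
Qed.

(** * Bilinearity and boundedness of the U-centered inner product *)

Section UdCov.
Context {R : realType} {n : nat}.
Implicit Types A B : 'M[R]_n.

(** Centering is built in, so that bilinearity can be applied to uncentered matrices; [dCov2] is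
    this form at the two distance matrices. *)
Definition UdCov A B : R := Uinner (Ucenter A) (Ucenter B).

Lemma UdCovC A B : UdCov A B = UdCov B A.
Proof.
congr (_ * _); apply: eq_bigr => s _; apply: eq_bigr => t _; exact: mulrC.
Qed.

Lemma Ucenter_linear a A B : Ucenter (a *: A + B) = a *: Ucenter A + Ucenter B.
Proof.
apply/matrixP => s t; rewrite !mxE; case: eqP => [_|_]; first by rewrite mulr0 addr0.
have E (f g : 'I_n -> R) : \sum_v (a * f v + g v) = a * (\sum_v f v) + \sum_v g v.
  by rewrite big_split mulr_sumr.
under eq_bigr do rewrite !mxE.
under [\sum_(u < n) (a *: A + B) u t]eq_bigr do rewrite !mxE.
under [X in _ + _ * X = _]eq_bigr do under eq_bigr do rewrite !mxE.
under [X in _ + _ * X = _]eq_bigr do rewrite E.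
rewrite !E; ring.
Qed.

Lemma UdCov_linearl a A A' B : UdCov (a *: A + A') B = a * UdCov A B + UdCov A' B.
Proof.
rewrite /UdCov Ucenter_linear /Uinner mulrCA -mulrDr; congr (_ * _).
rewrite mulr_sumr -big_split; apply: eq_bigr => s _.
rewrite mulr_sumr -big_split; apply: eq_bigr => t _ /=.
by rewrite !mxE; ring.
Qed.

Lemma UdCov0 B : UdCov 0 B = 0.
Proof.
by have := UdCov_linearl (-1) 0 0 B; rewrite scaler0 addr0 mulN1r addNr.
Qed.

Lemma UdCovDl A A' B : UdCov (A + A') B = UdCov A B + UdCov A' B.
Proof. by rewrite -[A]scale1r UdCov_linearl scale1r mul1r. Qed.

Lemma UdCovZl a A B : UdCov (a *: A) B = a * UdCov A B.
Proof. by rewrite -[a *: A]addr0 UdCov_linearl UdCov0 addr0. Qed.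

Lemma UdCovDr A A' B : UdCov B (A + A') = UdCov B A + UdCov B A'.
Proof. by rewrite UdCovC UdCovDl !(UdCovC B). Qed.

Lemma UdCovZr a A B : UdCov B (a *: A) = a * UdCov B A.
Proof. by rewrite UdCovC UdCovZl UdCovC. Qed.

Lemma UdCov_suml m (A : 'I_m -> 'M[R]_n) B :
  UdCov (\sum_i A i) B = \sum_i UdCov (A i) B.
Proof. by rewrite (big_morph _ (fun A A' => UdCovDl A A' B) (UdCov0 B)). Qed.

Lemma UdCov_sumr m (A : 'I_m -> 'M[R]_n) B :
  UdCov B (\sum_i A i) = \sum_i UdCov B (A i).
Proof. by rewrite UdCovC UdCov_suml; apply: eq_bigr => i _; rewrite UdCovC. Qed.

Definition off_diag1 : 'M[R]_n := \matrix_(s, t) (s != t)%:R.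

(** All row and column sums are n - 1, so an off-diagonal entry becomes 1 - 2 (n-1)/(n-2) + n/(n-2)
    = 0. The zero diagonal is essential: the full matrix of ones would give -1/(n-1). *)
Lemma Ucenter_off_diag1 : (3 <= n)%N -> Ucenter off_diag1 = 0.
Proof.
move=> n3; apply/matrixP => s t; rewrite !mxE; case: eqP => // _ /=.
have n2 : n%:R - 2 != 0 :> R by rewrite subr_eq0 eqr_nat; case: eqP n3 => // ->.
have n1 : n%:R - 1 != 0 :> R by rewrite subr_eq0 pnatr_eq1; case: eqP n3 => // ->.
have row u : \sum_v off_diag1 u v = n%:R - 1.
  under eq_bigr do rewrite mxE eq_sym.
  rewrite (bigD1 u) //= eqxx add0r (eq_bigr (fun=> 1)) => [|v ->] //.
  by rewrite sum_neq1 sumr_const card_ord.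
have col v : \sum_u off_diag1 u v = n%:R - 1.
  by rewrite -[RHS](row v); apply: eq_bigr => u _; rewrite !mxE eq_sym.
under [X in _ + _ * X = _]eq_bigr do rewrite row.
rewrite row col sumr_const card_ord -(mulr_natl (_ - _) n) /=; field.
by rewrite n1 n2.
Qed.

Lemma UdCov_off_diag1 B : (3 <= n)%N -> UdCov off_diag1 B = 0.
Proof.
move=> n3; rewrite /UdCov /Uinner Ucenter_off_diag1 // big1 ?mulr0 // => s _.
by rewrite big1 // => t _; rewrite mxE mul0r.
Qed.

Lemma Ucenter_bound : exists2 K : R, 0 < K &
  forall A a, 0 <= a -> (forall s t, `|A s t| <= a) ->
    forall s t, `|Ucenter A s t| <= K * a.
Proof.
(* The four summands bound the entry, its row sum, its column sum and the total sum. *)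
exists (1 + `|(n%:R - 2)^-1| * n%:R + `|(n%:R - 2)^-1| * n%:R
        + `|((n%:R - 1) * (n%:R - 2))^-1| * (n%:R * n%:R)).
  by rewrite -!addrA ltr_pwDl // ?addr_ge0 // !mulr_ge0.
move=> A a a0 Aa s t; rewrite mxE; case: eqP => _.
  by rewrite normr0 mulr_ge0 // !addr_ge0 // !mulr_ge0.
rewrite !mulrDl mul1r; apply: (le_trans (ler_normD _ _)); apply: lerD; last first.
  rewrite normrM -!mulrA ler_wpM2l //.
  by apply/ler_norm_sum_ord => u; apply/ler_norm_sum_ord => v.
apply: (le_trans (ler_normB _ _)); apply: lerD; last first.
  by rewrite normrM -!mulrA ler_wpM2l //; exact: ler_norm_sum_ord.
apply: (le_trans (ler_normB _ _)); apply: lerD => //.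
by rewrite normrM -!mulrA ler_wpM2l //; exact: ler_norm_sum_ord.
Qed.

Lemma UdCov_bound : exists2 K : R, 0 < K &
  forall A B a b, 0 <= a -> 0 <= b ->
    (forall s t, `|A s t| <= a) -> (forall s t, `|B s t| <= b) ->
    `|UdCov A B| <= K * (a * b).
Proof.
have [K K0 HK] := Ucenter_bound.
(* The added 1 keeps the constant positive also for n = 0 and n = 3, where the inverse is 0 by
   convention. *)
exists (`|(n%:R * (n%:R - 3))^-1| * ((n%:R * n%:R) * (K * K)) + 1).
  by rewrite ltr_wpDl // !mulr_ge0 // ltW.
move=> A B a b a0 b0 /(HK _ _ a0) UA /(HK _ _ b0) UB.
have KK : 0 <= K * a * (K * b) by rewrite !mulr_ge0 // ltW.
apply: (@le_trans _ _ (`|(n%:R * (n%:R - 3))^-1| * ((n%:R * n%:R) * (K * a * (K * b))))).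
  rewrite normrM -mulrA ler_wpM2l // ler_norm_sum_ord // => s.
  rewrite big_mkcond ler_norm_sum_ord // => t.
  by case: ifP => _; rewrite ?normr0 // normrM ler_pM.
rewrite (_ : K * a * (K * b) = K * K * (a * b)); last by ring.
rewrite mulrDl mul1r -!mulrA lerDl.
by rewrite mulr_ge0.
Qed.

End UdCov.

(** * Expansion of the distance matrices around tau *)

Section decomposition.
Context {R : realType} {n : nat} (n4 : (4 <= n)%N).

Definition sqdistmx {m : nat} (X : 'I_n -> m.-tuple R) : 'M[R]_n :=
  \matrix_(s, t) Defs.edist (X s) (X t) ^+ 2.

Lemma edistxx {m : nat} (u : m.-tuple R) : Defs.edist u u = 0.
Proof. by rewrite /Defs.edist big1 ?sqrtr0 // => i _; rewrite subrr expr0n. Qed.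

Lemma sqr_edist {m : nat} (u v : m.-tuple R) :
  Defs.edist u v ^+ 2 = \sum_(i < m) (tnth u i - tnth v i) ^+ 2.
Proof. by rewrite sqr_sqrtr // sumr_ge0 // => i _; exact: sqr_ge0. Qed.

Lemma sum_cov2 {p q : nat} (X : 'I_n -> p.-tuple R) (Y : 'I_n -> q.-tuple R) :
  \sum_(i < p) \sum_(j < q) cov2 (fun s => tnth (X s) i) (fun s => tnth (Y s) j)
  = 4^-1 * UdCov (sqdistmx X) (sqdistmx Y).
Proof.
have E (m : nat) (Z : 'I_n -> m.-tuple R) :
    sqdistmx Z = \sum_i \matrix_(s, t) (tnth (Z s) i - tnth (Z t) i) ^+ 2.
  apply/matrixP => s t; rewrite summxE mxE sqr_edist.
  by apply: eq_bigr => i _; rewrite mxE.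
rewrite !E UdCov_suml mulr_sumr; apply: eq_bigr => i _.
rewrite UdCov_sumr mulr_sumr; apply: eq_bigr => j _.
exact: cov2_Uinner.
Qed.

(* With r = |X_s - X_t| / tau and L = r^2 - 1, the Taylor remainder of
   r = sqrt (1 + L) at first order is exactly - (r - 1)^2 / 2. *)
Definition Lmx (tau : R) {m : nat} (X : 'I_n -> m.-tuple R) : 'M[R]_n :=
  \matrix_(s, t) if s == t then 0 else (Defs.edist (X s) (X t) ^+ 2 - tau ^+ 2) / tau ^+ 2.

Definition Tmx (tau : R) {m : nat} (X : 'I_n -> m.-tuple R) : 'M[R]_n :=
  \matrix_(s, t) if s == t then 0 else - ((Defs.edist (X s) (X t) / tau - 1) ^+ 2 / 2).

Lemma distmxE tau {m : nat} (X : 'I_n -> m.-tuple R) : tau != 0 ->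
  distmx X = tau *: (off_diag1 + 2^-1 *: Lmx tau X + Tmx tau X).
Proof.
move=> t0; apply/matrixP => s t; rewrite !mxE; case: eqP => [->|_] /=.
  by rewrite edistxx; ring.
by field.
Qed.

Lemma sqdistmxE tau {m : nat} (X : 'I_n -> m.-tuple R) : tau != 0 ->
  sqdistmx X = tau ^+ 2 *: (off_diag1 + Lmx tau X).
Proof.
move=> t0; apply/matrixP => s t; rewrite !mxE; case: eqP => [->|_] /=.
  by rewrite edistxx; ring.
by field.
Qed.

(** With r >= 0, |L| = |r - 1| (r + 1) >= |r - 1|, hence (r - 1)^2 / 2 <= L^2 without any
    restriction on a. *)
Lemma Tmx_le tau {m : nat} (X : 'I_n -> m.-tuple R) a : 0 < tau -> 0 <= a ->
  (forall s t, `|Lmx tau X s t| <= a) -> forall s t, `|Tmx tau X s t| <= a ^+ 2.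
Proof.
move=> t0 a0 H s t; have := H s t; rewrite !mxE; case: eqP => [_ _|_ La].
  by rewrite normr0 sqr_ge0.
set r := Defs.edist _ _ / tau.
have r0 : 0 <= r by rewrite divr_ge0 ?sqrtr_ge0 // ltW.
have Lr : (Defs.edist (X s) (X t) ^+ 2 - tau ^+ 2) / tau ^+ 2 = (r - 1) * (r + 1).
  by rewrite /r; field; rewrite gt_eqF.
rewrite Lr in La.
rewrite normrN ger0_norm ?divr_ge0 ?sqr_ge0 //.
have : ((r - 1) * (r + 1)) ^+ 2 <= a ^+ 2.
  by rewrite -[leLHS]real_normK ?num_real // ler_sqr // nnegrE.
apply: le_trans; rewrite exprMn.
have := sqr_ge0 (r - 1).
have : 1 <= (r + 1) ^+ 2 by rewrite -[leLHS](expr1n _ 2) ler_sqr ?nnegrE ?lerDr ?addr_ge0.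
nra.
Qed.

(** The constant is chosen before the dimensions, the scales and the samples, so a single K serves
    all p, q and all outcomes. The three remainder rates come from the products of L with T, T with
    L and T with T. *)
Lemma dCov2_bound : exists2 K : R, 0 < K &
  forall (tX tY : R), 0 < tX -> 0 < tY ->
  forall (p q : nat) (X : 'I_n -> p.-tuple R) (Y : 'I_n -> q.-tuple R) a b,
  0 <= a -> 0 <= b ->
  (forall s t, `|Lmx tX X s t| <= a) -> (forall s t, `|Lmx tY Y s t| <= b) ->
  let lead := (tX * tY)^-1 * \sum_(i < p) \sum_(j < q)
     cov2 (fun s => tnth (X s) i) (fun s => tnth (Y s) j) in
  `|lead| <= K * (tX * tY * a * b) /\
  `|dCov2 X Y - lead| <= K * (tX * tY * (a ^+ 2 * b + a * b ^+ 2 + a ^+ 2 * b ^+ 2)).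
Proof.
have [K K0 HK] := @UdCov_bound R n.
have n3 : (3 <= n)%N by exact: ltnW.
exists K => // tX tY tX0 tY0 p q X Y a b a0 b0 La Lb lead.
have Ta := @Tmx_le _ _ _ _ tX0 a0 La; have Tb := @Tmx_le _ _ _ _ tY0 b0 Lb.
have tXn : tX != 0 by rewrite gt_eqF.
have tYn : tY != 0 by rewrite gt_eqF.
have a2 := sqr_ge0 a; have b2 := sqr_ge0 b.
have t0 : 0 <= tX * tY by rewrite mulr_ge0 // ltW.
have J (B : 'M[R]_n) : UdCov B off_diag1 = 0 by rewrite UdCovC UdCov_off_diag1.
have leadE : lead = tX * tY * (4^-1 * UdCov (Lmx tX X) (Lmx tY Y)).
  rewrite /lead sum_cov2 (sqdistmxE tX) // (sqdistmxE tY) //.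
  rewrite UdCovZl UdCovZr UdCovDl UdCov_off_diag1 // add0r UdCovDr J add0r.
  by field; rewrite tXn tYn.
have RE : dCov2 X Y - lead = tX * tY *
    (2^-1 * UdCov (Lmx tX X) (Tmx tY Y) + 2^-1 * UdCov (Tmx tX X) (Lmx tY Y)
     + UdCov (Tmx tX X) (Tmx tY Y)).
  rewrite leadE /dCov2 -/(UdCov _ _) (distmxE tX) // (distmxE tY) //.
  rewrite UdCovZl UdCovZr -!addrA UdCovDl UdCov_off_diag1 // add0r UdCovDr J add0r.
  by rewrite UdCovDl !UdCovDr !UdCovZl !UdCovZr; field.
split.
  rewrite leadE normrM (ger0_norm t0) (_ : K * _ = tX * tY * (K * (a * b))); last by ring.
  rewrite ler_wpM2l //.
  rewrite normrM ger0_norm //.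
  have := HK _ _ _ _ a0 b0 La Lb; have := normr_ge0 (UdCov (Lmx tX X) (Lmx tY Y)); lra.
rewrite RE normrM (ger0_norm t0) [leRHS]mulrCA ler_wpM2l //.
have h1 := HK _ _ _ _ a0 b2 La Tb; have h2 := HK _ _ _ _ a2 b0 Ta Lb.
have h3 := HK _ _ _ _ a2 b2 Ta Tb.
rewrite (le_trans (ler_normD _ _)) // mulrDr lerD //.
rewrite (le_trans (ler_normD _ _)) // !(normrM 2^-1) (@ger0_norm _ 2^-1) //.
have := normr_ge0 (UdCov (Lmx tX X) (Tmx tY Y)).
have := normr_ge0 (UdCov (Tmx tX X) (Lmx tY Y)).
lra.
Qed.

End decomposition.

(** * Independence and expectation *)

Lemma measurable_fun_preimage {d1 d2} {T1 : measurableType d1}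
    {T2 : measurableType d2} (f : T1 -> T2) (A : set T2) :
  measurable_fun setT f -> measurable A -> measurable (f @^-1` A).
Proof. by move=> mf mA; rewrite -[X in measurable X]setTI; exact: mf. Qed.

Section uniqueness_on_rectangles.
Context {d1 d2 : measure_display} {T1 : measurableType d1} {T2 : measurableType d2}
  {R : realType}.

(** Rectangles are a generating family closed under intersection. The measures are only required to
    be finite, so that restrictions to an event are covered besides joint laws. *)
Lemma eq_measure_prod (m1 m2 : {measure set (T1 * T2) -> \bar R}) :
  (m1 setT < +oo)%E ->
  (forall A B, measurable A -> measurable B -> m1 (A `*` B) = m2 (A `*` B)) ->
  forall C, measurable C -> m1 C = m2 C.
Proof.
move=> m1oo m12.
pose G : set (set (T1 * T2)) :=
  [set C | exists A, measurable A /\ exists B, measurable B /\ C = A `*` B].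
move=> C mC; apply: (measure_unique G (fun=> setT)) => //.
- rewrite measurable_prod_measurableType //; congr (<<s _ >>).
  rewrite predeqE => S; split => [[A mA [B mB <-]]|[A [mA [B [mB ->]]]]].
    by exists A; split => //; exists B.
  by exists A => //; exists B.
- move=> /= _ _ [X1 [mX1 [X2 [mX2 ->]]]] [Y1 [mY1 [Y2 [mY2 ->]]]].
  rewrite -setXI; exists (X1 `&` Y1); split; first exact: measurableI.
  by exists (X2 `&` Y2); split => //; exact: measurableI.
- by move=> _; exists setT; split => //; exists setT; split => //; rewrite setXTT.
- by rewrite bigcup_const //; exists 0%N.
- by move=> _ [A [mA [B [mB ->]]]]; exact: m12.
Qed.

End uniqueness_on_rectangles.

Section independence.
Context {d : measure_display} {T : measurableType d} {R : realType}
  (P : probability T R).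

Definition independent {d1 d2} {T1 : measurableType d1} {T2 : measurableType d2}
    (U : T -> T1) (V : T -> T2) : Prop :=
  forall A B, measurable A -> measurable B ->
    P (U @^-1` A `&` V @^-1` B) = (P (U @^-1` A) * P (V @^-1` B))%E.

Lemma independent_comp {d1 d2 d3 d4} {T1 : measurableType d1} {T2 : measurableType d2}
    {T3 : measurableType d3} {T4 : measurableType d4}
    (U : T -> T1) (V : T -> T2) (f : T1 -> T3) (g : T2 -> T4) :
  measurable_fun setT f -> measurable_fun setT g ->
  independent U V -> independent (f \o U) (g \o V).
Proof.
move=> mf mg UV A B mA mB.
exact: (UV _ _ (measurable_fun_preimage _ _ mf mA) (measurable_fun_preimage _ _ mg mB)).
Qed.

Lemma same_law_comp {d1 d2} {T1 : measurableType d1} {T2 : measurableType d2}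
    (U V : T -> T1) (f : T1 -> T2) :
  measurable_fun setT f -> same_law P U V -> same_law P (f \o U) (f \o V).
Proof.
by move=> mf UV A mA; exact: (UV _ (measurable_fun_preimage _ _ mf mA)).
Qed.

Lemma same_law_pair {d1 d2} {T1 : measurableType d1} {T2 : measurableType d2}
    (U U' : T -> T1) (V V' : T -> T2) :
  measurable_fun setT U -> measurable_fun setT U' ->
  measurable_fun setT V -> measurable_fun setT V' ->
  independent U V -> independent U' V' ->
  same_law P U U' -> same_law P V V' ->
  same_law P (fun w => (U w, V w)) (fun w => (U' w, V' w)).
Proof.
move=> mU mU' mV mV' UV UV' UU' VV' C mC.
have mW := measurable_fun_pair mU mV; have mW' := measurable_fun_pair mU' mV'.
pose m1 := measure_function_pushforward__canonical__measure_function_Measure P mW.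
pose m2 := measure_function_pushforward__canonical__measure_function_Measure P mW'.
apply: (@eq_measure_prod _ _ _ _ _ m1 m2 _ _ C mC).
  by rewrite /m1 /= /pushforward preimage_setT probability_setT ltry.
move=> A B mA mB; rewrite /m1 /m2 /= /pushforward.
have E (f : T -> T1) (g : T -> T2) :
  (fun w => (f w, g w)) @^-1` (A `*` B) = f @^-1` A `&` g @^-1` B by [].
by rewrite !E UV // UV' // UU' // VV'.
Qed.

(** As functions of C both sides are finite measures: the law of the pair restricted to E, and the
    law of the pair scaled by P E. They agree on rectangles. *)
Lemma independent_pair_event {d1 d2} {T1 : measurableType d1} {T2 : measurableType d2}
    (U : T -> T1) (V : T -> T2) (E : set T) :
  measurable_fun setT U -> measurable_fun setT V -> measurable E ->
  (forall A B, measurable A -> measurable B ->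
    P (U @^-1` A `&` V @^-1` B `&` E) = (P (U @^-1` A `&` V @^-1` B) * P E)%E) ->
  forall C, measurable C ->
    P ((fun w => (U w, V w)) @^-1` C `&` E) =
    (P ((fun w => (U w, V w)) @^-1` C) * P E)%E.
Proof.
move=> mU mV mE UVE C mC.
have mUV := measurable_fun_pair mU mV.
pose mr := measure_function_mrestr__canonical__measure_function_Measure P mE.
pose m1 := measure_function_pushforward__canonical__measure_function_Measure mr mUV.
pose m0 := measure_function_pushforward__canonical__measure_function_Measure P mUV.
pose c : {nonneg R} := NngNum (fine_ge0 (measure_ge0 P E)).
have cE : c%:num%:E = P E by rewrite /= fineK // fin_num_measure.
pose m2 := mscale c m0.
rewrite muleC -cE.
apply: (@eq_measure_prod _ _ _ _ _ m1 m2 _ _ C mC).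
  rewrite /m1 /= /pushforward preimage_setT /mrestr setTI.
  by rewrite (le_lt_trans (probability_le1 _ _)) // ltry.
move=> A B mA mB; rewrite /m1 /m2 /= /pushforward /mrestr /mscale cE muleC.
exact: UVE.
Qed.

End independence.

Section expectation.
Context {d : measure_display} {T : measurableType d} {R : realType}
  (P : probability T R).

Lemma Lfun_measurable (f : T -> R) p : f \in Lfun P p -> measurable_fun setT f.
Proof. by move=> /sub_Lfun_mfun; rewrite inE. Qed.

Lemma Lfun2P (f : T -> R) : measurable_fun setT f ->
  ('E_P[(fun w => f w ^+ 2)%R] < +oo)%E -> f \in Lfun P 2%:E.
Proof.
move=> mf; rewrite unlock => f2; apply/andP; split; rewrite inE //=.
rewrite /finite_norm unlock /= poweR_lty //.
apply: le_lt_trans f2; rewrite le_eqVlt; apply/orP; left; apply/eqP.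
by apply: eq_integral => w _; rewrite /= powR_mulrn // real_normK ?num_real.
Qed.

Lemma Lfun21 (f : T -> R) : f \in Lfun P 2%:E -> f \in Lfun P 1.
Proof. by apply: Lfun_subset12; rewrite fin_num_measure. Qed.

Lemma expectation_sum_fin {I : finType} (p : pred I) (f : I -> T -> R) :
  (forall i, p i -> f i \in Lfun P 1) ->
  (fun w => \sum_(i | p i) f i w) \in Lfun P 1 /\
  ('E_P[(fun w => \sum_(i | p i) f i w)%R] = \sum_(i | p i) 'E_P[f i])%E.
Proof.
move=> Lf.
have -> : (fun w => \sum_(i | p i) f i w) = \sum_(i | p i) f i.
  by apply/funext => w; rewrite fct_sumE.
split; first exact: rpred_sum.
suff [] : (\sum_(i | p i) f i : T -> R) \in Lfun P 1 /\
  ('E_P[\sum_(i | p i) f i] = \sum_(i | p i) 'E_P[f i])%E by [].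
apply: (big_ind2 (fun (g : T -> R) e => g \in Lfun P 1 /\ ('E_P[g] = e)%E)) => //.
- by split; [exact: rpred0|exact: expectation_cst].
- move=> g1 e1 g2 e2 [L1 <-] [L2 <-]; split; first exact: rpredD.
  exact: expectationD.
- by move=> i pi; split=> //; exact: Lf.
Qed.

(** Independence makes the joint law the product of the two laws; the expectation of the product is
    then an iterated integral. *)
Lemma expectation_prod_independent (X Y : T -> R) : independent P X Y ->
  X \in Lfun P 1 -> Y \in Lfun P 1 ->
  (fun w => X w * Y w) \in Lfun P 1 /\
  ('E_P[(fun w => X w * Y w)%R] = 'E_P[X] * 'E_P[Y])%E.
Proof.
move=> XY LX LY.
have mX := Lfun_measurable _ _ LX; have mY := Lfun_measurable _ _ LY.
have /integrableP[_ iX] := (Lfun1_integrable P X).1 LX.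
have /integrableP[_ iY] := (Lfun1_integrable P Y).1 LY.
pose X' : {mfun T >-> R} := mfun_Sub (mem_set mX).
pose Y' : {mfun T >-> R} := mfun_Sub (mem_set mY).
pose W' : {mfun T >-> (R * R)%type} := mfun_Sub (mem_set (measurable_fun_pair mX mY)).
pose mu := distribution P X'; pose nu := distribution P Y'.
have lawW C : measurable C -> (mu \x nu)%E C = distribution P W' C.
  by apply: product_measure_unique => A B mA mB; exact: XY.
pose M := EFin \o (fun z : R * R => z.1 * z.2).
have mM : measurable_fun setT M.
  by apply/measurable_EFinP; exact: measurable_funM.
(* Tonelli for |x y| comes first: Fubini presupposes the integrability obtained here. *)
have iW : (\int[P]_w `|(X w * Y w)%:E| < +oo)%E.
  have -> : (\int[P]_w `|(X w * Y w)%:E| =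
             \int[distribution P W']_z `|M z|)%E.
    rewrite (ge0_integral_distribution W' (f := abse \o M)) // => [|z].
      exact: measurableT_comp.
    exact: abse_ge0.
  have -> : (\int[distribution P W']_z `|M z| = \int[mu \x nu]_z `|M z|)%E.
    by apply: eq_measure_integral => C mC _; exact/esym/lawW.
  rewrite fubini_tonelli1 //; last exact: measurableT_comp.
  rewrite /fubini_F /=.
  have mN : measurable_fun setT (EFin \o (@Num.norm R R)).
    by apply/measurable_EFinP; exact: normr_measurable.
  have in0 : (0 <= \int[nu]_y `|y|%:E)%E by apply: integral_ge0 => y _; rewrite lee_fin.
  have inner x : (\int[nu]_y `|x * y|%:E = `|x|%:E * \int[nu]_y `|y|%:E)%E.
    rewrite -ge0_integralZl //.
    by apply: eq_integral => y _; rewrite normrM.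
  under eq_integral do rewrite inner.
  rewrite ge0_integralZr //.
  apply: lte_mul_pinfty.
  - by apply: integral_ge0 => y _; rewrite lee_fin.
  - rewrite ge0_fin_numE; last by apply: integral_ge0 => y _; rewrite lee_fin.
    rewrite (ge0_integral_distribution X' (f := EFin \o (@Num.norm R R))) //.
    by move=> x; rewrite lee_fin.
  - rewrite (ge0_integral_distribution Y' (f := EFin \o (@Num.norm R R))) //.
    by move=> x; rewrite lee_fin.
have iXY : P.-integrable setT (fun w => (X w * Y w)%:E).
  apply/integrableP; split=> //; apply/measurable_EFinP; exact: measurable_funM.
split; first exact/Lfun1_integrable.
have iP : (distribution P W').-integrable setT M.
  by apply: integrable_pushforward => //; exact: (measurable_funP W').
have iprod : (mu \x nu)%E.-integrable setT M.
  move/integrableP : iP => [_ iP]; apply/integrableP; split=> //.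
  have -> : (\int[mu \x nu]_z `|M z| = \int[distribution P W']_z `|M z|)%E.
    by apply: eq_measure_integral => C mC _; exact: lawW.
  by [].
have imu : mu.-integrable setT EFin.
  by apply: integrable_pushforward => //; exact/Lfun1_integrable.
have inu : nu.-integrable setT EFin.
  by apply: integrable_pushforward => //; exact/Lfun1_integrable.
have EX : ('E_P[X] = \int[mu]_x x%:E)%E.
  rewrite unlock (integral_distribution (X := X') (f := EFin)) //; exact/Lfun1_integrable.
have EY : ('E_P[Y] = \int[nu]_x x%:E)%E.
  rewrite unlock (integral_distribution (X := Y') (f := EFin)) //; exact/Lfun1_integrable.
rewrite EX EY unlock.
transitivity (\int[distribution P W']_z M z)%E.
  by rewrite (integral_distribution (X := W') (f := M)).
have -> : (\int[distribution P W']_z M z = \int[mu \x nu]_z M z)%E.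
  by apply: eq_measure_integral => C mC _; exact/esym/lawW.
rewrite -integral12_prod_meas1 // /fubini_F /=.
have inner x : (\int[nu]_y M (x, y) = x%:E * \int[nu]_y y%:E)%E by rewrite -integralZl.
under eq_integral do rewrite inner.
have /fineK <- : (\int[nu]_y y%:E)%E \is a fin_num by exact: integrable_fin_num.
by rewrite integralZr.
Qed.

Lemma ge0_same_law_integral {d1} {T1 : measurableType d1} (U V : T -> T1)
    (f : T1 -> \bar R) :
  measurable_fun setT U -> measurable_fun setT V -> same_law P U V ->
  measurable_fun setT f -> (forall x, 0 <= f x)%E ->
  (\int[P]_w f (U w) = \int[P]_w f (V w))%E.
Proof.
move=> mU mV UV mf f0.
have <- := ge0_integral_distribution (mfun_Sub (mem_set mU)) mf f0.
have <- := ge0_integral_distribution (mfun_Sub (mem_set mV)) mf f0.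
by apply: eq_measure_integral => A mA _; exact: UV.
Qed.

Lemma same_law_Lfun1 {d1} {T1 : measurableType d1} (U V : T -> T1) (f : T1 -> R) :
  measurable_fun setT U -> measurable_fun setT V -> same_law P U V ->
  measurable_fun setT f -> f \o U \in Lfun P 1 ->
  f \o V \in Lfun P 1 /\ ('E_P[f \o V] = 'E_P[f \o U])%E.
Proof.
move=> mU mV UV mf /Lfun1_integrable LU.
have mE : measurable_fun setT (EFin \o f) by exact/measurable_EFinP.
have LV : P.-integrable setT (EFin \o (f \o V)).
  move/integrableP : LU => [_ iU]; apply/integrableP; split.
    by apply/measurable_EFinP; exact: measurableT_comp.
  rewrite -(@ge0_same_law_integral _ _ _ _ (fun x => `|(f x)%:E|%E) mU mV UV) //.
  exact: measurableT_comp.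
split; first exact/Lfun1_integrable.
rewrite unlock.
have <- := @integral_distribution _ _ _ _ _ P (mfun_Sub (mem_set mU)) _ mE LU.
have <- := @integral_distribution _ _ _ _ _ P (mfun_Sub (mem_set mV)) _ mE LV.
by apply: eq_measure_integral => A mA _; apply/esym; exact: UV.
Qed.

End expectation.

(** * Independence of disjoint pairs and unbiasedness *)

Section unbiasedness.
Context {d : measure_display} {T : measurableType d} {R : realType}
  (P : probability T R).

Lemma mutually_independent_sub {d1} {T1 : measurableType d1} {I J : finType}
    (Z : I -> T -> T1) (f : J -> I) : injective f ->
  mutually_independent P Z -> mutually_independent P (fun j => Z (f j)).
Proof.
move=> finj ZI A mA.
(* The events are transported along [f]: by injectivity this intersection is [A j] at [f j], and
   outside the image it is empty, hence the whole space, contributing a factor 1. *)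
pose B i := \bigcap_(j in [set j | f j = i]) A j.
have BE j : B (f j) = A j.
  apply/seteqP; split=> [x /(_ j erefl) //|x Ax k /= /finj ->//].
have mB i : measurable (B i).
  by apply: fin_bigcap_measurable => // ? _.
have BT i : i \notin codom f -> B i = setT.
  move=> ni; rewrite -subTset => x _ j /= ji.
  by case/negP: ni; rewrite -ji codom_f.
have := ZI B mB.
rewrite (_ : \bigcap_(i in _) _ = \bigcap_(j in [set: J]) (Z (f j) @^-1` A j)); last first.
  apply/seteqP; split => w /= H.
    by move=> j _; rewrite -BE; exact: H.
  move=> i _; have [/codomP[j ->]|ni] := boolP (i \in codom f).
    by rewrite /preimage /= BE; exact: H.
  by rewrite BT.
move=> ->.
rewrite (bigID (mem (codom f))) /= [X in (_ * X)%E]big1 ?mule1; last first.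
  by move=> i ni; rewrite BT // preimage_setT probability_setT.
have ucod : uniq (codom f) by apply/injectiveP.
rewrite -(big_uniq _ ucod) /= big_image /=.
by apply: eq_bigr => j _; rewrite BE.
Qed.

Lemma mutually_independent2 {d1} {T1 : measurableType d1} {I : finType}
    (Z : I -> T -> T1) (s t : I) : s != t -> mutually_independent P Z ->
  independent P (Z s) (Z t).
Proof.
move=> st ZI A B mA mB.
pose f (b : bool) := if b then s else t.
have finj : injective f.
  by move=> [] [] //= /eqP; rewrite /f ?(negbTE st) // eq_sym (negbTE st).
have := mutually_independent_sub Z f finj ZI (fun b => if b then A else B).
rewrite big_bool /= => <-; last by case.
congr (P _); apply/seteqP; split=> [w [wA wB] [] _ //|w H].
by split; [exact: (H true)|exact: (H false)].
Qed.

(** Independence is known on fourfold rectangles ([H4]). It is lifted to arbitrary sets one pair at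
    a time, each time holding the event of the other pair fixed. *)
Lemma mutually_independent_pairs {d1} {T1 : measurableType d1} {I : finType}
    (Z : I -> T -> T1) (s t u v : I) : uniq [:: s; t; u; v] ->
  (forall i, measurable_fun setT (Z i)) -> mutually_independent P Z ->
  independent P (fun w => (Z s w, Z t w)) (fun w => (Z u w, Z v w)).
Proof.
rewrite /= !inE !negb_or => /andP[/and3P[st su sv] /andP[/andP[tu tv] /andP[uv _]]] mZ ZI.
pose f (b : bool * bool) := if b.1 then (if b.2 then s else t) else (if b.2 then u else v).
have finj : injective f.
  by move=> [[] []] [[] []] //= /eqP; rewrite /f /= ?[t == s]eq_sym ?[u == _]eq_sym
    ?[v == _]eq_sym ?(negbTE st, negbTE su, negbTE sv, negbTE tu, negbTE tv, negbTE uv).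
have H4 A B C D : measurable A -> measurable B -> measurable C -> measurable D ->
    P ((Z s @^-1` A `&` Z t @^-1` B) `&` (Z u @^-1` C `&` Z v @^-1` D)) =
    (P (Z s @^-1` A) * P (Z t @^-1` B) * (P (Z u @^-1` C) * P (Z v @^-1` D)))%E.
  move=> mA mB mC mD.
  have := mutually_independent_sub Z f finj ZI (fun b => if b.1
    then (if b.2 then A else B) else (if b.2 then C else D)).
  rewrite -(pair_bigA _ (fun i j => P (Z (f (i, j)) @^-1` (if i
    then (if j then A else B) else (if j then C else D))))) /= !big_bool /= => <-; last first.
    by move=> [[] []].
  congr (P _); apply/seteqP; split=> [w [[wA wB] [wC wD]] [[] []] _ //|w H].
  by split; split; [exact: (H (true, true))|exact: (H (true, false))|
    exact: (H (false, true))|exact: (H (false, false))].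
have iP := mutually_independent2 Z _ _ _ ZI.
have mpre i A := @measurable_fun_preimage _ _ _ _ (Z i) A (mZ i).
have mst : measurable_fun setT (fun w => (Z s w, Z t w)) by exact: measurable_fun_pair.
move=> A B mA mB.
rewrite setIC muleC; apply: (independent_pair_event _ _ _ _ (mZ u) (mZ v)) => //.
  exact: measurable_fun_preimage.
move=> C D mC mD.
rewrite setIC muleC; apply: (independent_pair_event _ _ _ _ (mZ s) (mZ t)) => //.
  by apply: measurableI; exact: mpre.
by move=> A' B' mA' mB'; rewrite H4 // !iP.
Qed.

(** Expanding the product gives two terms E[uv] and, by independence, two terms E[u] E[v]. The case
    u = v yields twice the variance, which is how tau is computed. *)
Lemma expectation_diff_prod {d1} {T1 : measurableType d1} (Z0 Z Z' : T -> T1)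
    (u v : T1 -> R) :
  measurable_fun setT Z0 -> measurable_fun setT Z -> measurable_fun setT Z' ->
  measurable_fun setT u -> measurable_fun setT v ->
  same_law P Z0 Z -> same_law P Z0 Z' -> independent P Z Z' ->
  u \o Z0 \in Lfun P 2%:E -> v \o Z0 \in Lfun P 2%:E ->
  (fun w => (u (Z w) - u (Z' w)) * (v (Z w) - v (Z' w))) \in Lfun P 1 /\
  ('E_P[(fun w => (u (Z w) - u (Z' w)) * (v (Z w) - v (Z' w)))%R] =
   2%:E * covariance P (u \o Z0) (v \o Z0))%E.
Proof.
move=> mZ0 mZ mZ' mu mv lZ lZ' ZZ' u2 v2.
have u1 := Lfun21 _ _ u2; have v1 := Lfun21 _ _ v2.
have uv1 := Lfun2_mul_Lfun1 u2 v2.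
have muv : measurable_fun setT (fun x => u x * v x) by exact: measurable_funM.
have [uZ EuZ] := same_law_Lfun1 _ _ _ _ mZ0 mZ lZ mu u1.
have [vZ EvZ] := same_law_Lfun1 _ _ _ _ mZ0 mZ lZ mv v1.
have [uZ' EuZ'] := same_law_Lfun1 _ _ _ _ mZ0 mZ' lZ' mu u1.
have [vZ' EvZ'] := same_law_Lfun1 _ _ _ _ mZ0 mZ' lZ' mv v1.
have [uvZ EuvZ] := same_law_Lfun1 _ _ _ _ mZ0 mZ lZ muv uv1.
have [uvZ' EuvZ'] := same_law_Lfun1 _ _ _ _ mZ0 mZ' lZ' muv uv1.
have [L1 E1] := expectation_prod_independent _ _ _
  (independent_comp P _ _ _ _ mu mv ZZ') uZ vZ'.
have [L2 E2] := expectation_prod_independent _ _ _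
  (independent_comp P _ _ _ _ mv mu ZZ') vZ uZ'.
rewrite covarianceE //.
pose f1 w := u (Z w) * v (Z w). pose f2 w := u (Z w) * v (Z' w).
pose f3 w := v (Z w) * u (Z' w). pose f4 w := u (Z' w) * v (Z' w).
have -> : (fun w => (u (Z w) - u (Z' w)) * (v (Z w) - v (Z' w))) =
    ((f1 \- f2) \- f3) \+ f4.
  by apply/funext => w; rewrite /f1 /f2 /f3 /f4 /=; ring.
have LB (f g : T -> R) : f \in Lfun P 1 -> g \in Lfun P 1 -> f \- g \in Lfun P 1.
  by move=> Lf Lg; exact: (rpredB Lf Lg).
have LD (f g : T -> R) : f \in Lfun P 1 -> g \in Lfun P 1 -> f \+ g \in Lfun P 1.
  by move=> Lf Lg; exact: (rpredD Lf Lg).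
have L12 := LB _ _ uvZ L1; have L123 := LB _ _ L12 L2.
split; first exact: LD.
rewrite expectationD // expectationB // expectationB //.
rewrite (E1 : 'E_P[f2] = _)%E (E2 : 'E_P[f3] = _)%E.
rewrite (EuvZ : 'E_P[f1] = _)%E (EuvZ' : 'E_P[f4] = _)%E EuZ EvZ EuZ' EvZ'.
have := expectation_fin_num u1; have := expectation_fin_num v1.
have : ('E_P[(u \o Z0) * (v \o Z0)])%E \is a fin_num by exact: expectation_fin_num.
rewrite (_ : 'E_P[(fun x => (u x * v x)%R) \o Z0] = 'E_P[(u \o Z0) * (v \o Z0)])%E //.
case: ('E_P[(u \o Z0) * (v \o Z0)])%E => [x| |] //.
case: ('E_P[v \o Z0])%E => [y| |] //; case: ('E_P[u \o Z0])%E => [z| |] // _ _ _.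
by congr (_%:E); ring.
Qed.

(** In each term of [cov2E] the pairs (s, t) and (u, v) are disjoint, hence independent, and the
    term has expectation 4^-1 times (2c)(2c) = c^2, with c the covariance. A single variable [Z0]
    with two functions u, v keeps X and Y jointly distributed. *)
Lemma cov2_unbiased {d1} {T1 : measurableType d1} {n : nat} (Z0 : T -> T1)
    (Z : 'I_n -> T -> T1) (u v : T1 -> R) : (4 <= n)%N ->
  measurable_fun setT Z0 -> (forall i, measurable_fun setT (Z i)) ->
  measurable_fun setT u -> measurable_fun setT v ->
  iid_copies P Z0 Z ->
  u \o Z0 \in Lfun P 2%:E -> v \o Z0 \in Lfun P 2%:E ->
  ('E_P[fun w => cov2 (fun s => u (Z s w)) (fun s => v (Z s w))] =
   covariance P (u \o Z0) (v \o Z0) ^+ 2)%E.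
Proof.
move=> n4 mZ0 mZ mu mv [ZI lZ] u2 v2.
have : covariance P (u \o Z0) (v \o Z0) \is a fin_num.
  exact: (covariance_fin_num (Lfun21 _ _ u2) (Lfun21 _ _ v2) (Lfun2_mul_Lfun1 u2 v2)).
case ce : (covariance _ _ _) => [c| |] // _.
have lZ0 s : same_law P Z0 (Z s) by move=> A mA; rewrite lZ.
pose D s t w := (u (Z s w) - u (Z t w)) * (v (Z s w) - v (Z t w)).
pose g (x : T1 * T1) := (u x.1 - u x.2) * (v x.1 - v x.2).
have mg : measurable_fun setT g.
  by apply: measurable_funM; apply: measurable_funB;
    (apply: measurableT_comp => //; exact: measurable_fst || exact: measurable_snd).
have DL s t : s != t -> D s t \in Lfun P 1 /\ ('E_P[D s t] = (2 * c)%:E)%E.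
  by move=> st; rewrite EFinM -ce; apply: expectation_diff_prod => //; exact: mutually_independent2.
pose h (z : 4.-tuple 'I_n) : T -> R :=
  4^-1 \o* (fun w => D (tnth z o4_0) (tnth z o4_1) w * D (tnth z o4_2) (tnth z o4_3) w).
have hL (z : 4.-tuple 'I_n) : uniq z -> h z \in Lfun P 1 /\ ('E_P[h z] = (c ^+ 2)%:E)%E.
  move=> uz.
  have inj := elimT (tuple_uniqP _) uz.
  have st : tnth z o4_0 != tnth z o4_1 by apply/eqP => /inj.
  have uv : tnth z o4_2 != tnth z o4_3 by apply/eqP => /inj.
  have u4 : uniq [:: tnth z o4_0; tnth z o4_1; tnth z o4_2; tnth z o4_3].
    by rewrite /= !inE !(inj_eq inj).
  have [L1 E1] := DL _ _ st; have [L2 E2] := DL _ _ uv.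
  have [L E] := expectation_prod_independent _ _ _
    (independent_comp P _ _ _ _ mg mg (mutually_independent_pairs _ _ _ _ _ u4 mZ ZI)) L1 L2.
  split; first exact: Lfun_scale.
  rewrite expectationZl // (etrans E (congr2 mule E1 E2)).
  by rewrite -!EFinM; congr (_%:E); field.
have [L E] := expectation_sum_fin P _ _ (fun z uz => (hL z uz).1).
rewrite (_ : (fun w => _) = (n ^_ 4)%:R^-1 \o* (fun w => \sum_(z : 4.-tuple 'I_n | uniq z) h z w)).
  rewrite expectationZl // E.
  rewrite (eq_bigr (fun=> (c ^+ 2)%:E)) => [|z uz]; last by have [] := hL _ uz.
  rewrite sumEFin sumr_const -EFin_expe -EFinM; congr (_%:E).
  have -> : #|[pred z : 4.-tuple 'I_n | uniq z]| = (n ^_ 4)%N.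
    rewrite -[X in (X ^_ _)%N]card_ord -[in RHS](@card_uniq_tuples 'I_n 4 predT).
    by rewrite cardsE; apply: eq_card => z; rewrite -[RHS]/(all predT z && uniq z) all_predT.
  by rewrite -(mulr_natl (c ^+ 2)) mulKf // pnatr_eq0 -lt0n ffact_gt0.
apply/funext => w; rewrite cov2E /= mulrC; congr (_ * _); apply: eq_bigr => z _.
by rewrite /h /D /=; ring.
Qed.
End unbiasedness.

(** * Distances between independent copies *)

Section measurability.
Context {d : measure_display} {T : measurableType d} {R : realType}.

Lemma measurable_edist {m : nat} (U V : T -> m.-tuple R) :
  measurable_fun setT U -> measurable_fun setT V ->
  measurable_fun setT (fun w => Defs.edist (U w) (V w)).
Proof.
move=> mU mV; rewrite /Defs.edist.
apply: (measurableT_comp (continuous_measurable_fun (@sqrt_continuous R))).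
apply: measurable_sum => i; apply: measurable_funX; apply: measurable_funB.
  exact: (measurableT_comp (measurable_tnth i) mU).
exact: (measurableT_comp (measurable_tnth i) mV).
Qed.

Lemma measurable_UdCov {n : nat} (A B : T -> 'M[R]_n) :
  (forall s t, measurable_fun setT (fun w => A w s t)) ->
  (forall s t, measurable_fun setT (fun w => B w s t)) ->
  measurable_fun setT (fun w => UdCov (A w) (B w)).
Proof.
have mU (C : T -> 'M[R]_n) : (forall s t, measurable_fun setT (fun w => C w s t)) ->
    forall s t, measurable_fun setT (fun w => Ucenter (C w) s t).
  move=> mC s t; under eq_fun do rewrite mxE.
  case: eqP => _; first exact: measurable_cst.
  apply: measurable_funD; last first.
    by apply: measurable_funM => //; do 2!apply: measurable_sum => ?.
  apply: measurable_funB; last by apply: measurable_funM => //; apply: measurable_sum.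
  by apply: measurable_funB => //; apply: measurable_funM => //; apply: measurable_sum.
move=> /mU mA /mU mB; apply: measurable_funM => //.
apply: measurable_sum => s; under eq_fun do rewrite big_mkcond.
by apply: measurable_sum => t; case: (s != t) => //; exact: measurable_funM.
Qed.

Lemma measurable_exceed (f : T -> R) (c : R) : measurable_fun setT f ->
  measurable [set w | c < `|f w|].
Proof.
move=> mf.
have mb : measurable_fun setT (fun w => c < `|f w|).
  by apply: measurable_fun_ltr => //; exact: measurableT_comp.
exact: (@measurable_fun_preimage _ _ _ _ _ [set true] mb).
Qed.

End measurability.

Section distances.
Context {d : measure_display} {T : measurableType d} {R : realType}
  (P : probability T R).

(** The square of tau is twice the sum of the coordinate variances, so one nondegenerate coordinate
    is enough. *)
Lemma tau_of_gt0 {m : nat} (U U' : T -> m.-tuple R) (i0 : 'I_m) :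
  measurable_fun setT U -> measurable_fun setT U' ->
  same_law P U U' -> independent P U U' ->
  (forall i, (fun w => tnth (U w) i) \in Lfun P 2%:E) ->
  (0 < 'V_P[fun w => tnth (U w) i0])%E ->
  0 < tau_of P U U'.
Proof.
move=> mU mU' UU' iUU' L2 V0.
pose g i w := (tnth (U w) i - tnth (U' w) i) * (tnth (U w) i - tnth (U' w) i).
have gE i : g i \in Lfun P 1 /\
    ('E_P[g i] = 2%:E * covariance P (fun w => tnth (U w) i) (fun w => tnth (U w) i))%E.
  by apply: (@expectation_diff_prod _ _ _ P _ _ U U U'
      (fun x => tnth x i) (fun x => tnth x i)) => //;
    solve [exact: (measurable_tnth i)|exact: L2|by move=> A mA].
have [_ E] := expectation_sum_fin P xpredT g (fun i _ => (gE i).1).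
rewrite /tau_of sqrtr_gt0.
rewrite (_ : (fun w => _) = (fun w => \sum_i g i w)); last first.
  by apply/funext => w; rewrite sqr_edist; apply: eq_bigr => i _; rewrite expr2.
rewrite E.
have Vfin i : 'V_P[fun w => tnth (U w) i]%E \is a fin_num by exact: variance_fin_num.
rewrite (eq_bigr (fun i => (2 * fine 'V_P[fun w => tnth (U w) i]%E)%:E)); last first.
  by move=> i _; rewrite (gE i).2 EFinM fineK.
rewrite sumEFin /= (bigD1 i0) //= ltr_wpDr //.
  by apply: sumr_ge0 => i _; rewrite mulr_ge0 // fine_ge0 // variance_ge0.
by rewrite mulr_gt0 // fine_gt0 // V0 /= ltey_eq Vfin.
Qed.

Lemma probability_bigsetU {I : Type} (r : seq I) (p : pred I) (A : I -> set T) :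
  (forall i, p i -> measurable (A i)) ->
  (P (\big[setU/set0]_(i <- r | p i) A i) <= \sum_(i <- r | p i) P (A i))%E.
Proof.
move=> mA; elim: r => [|i r IH]; first by rewrite !big_nil measure0.
rewrite !big_cons; case: ifP => // pi.
apply: le_trans (measureU2 _ (mA _ pi) (bigsetU_measurable _ mA)) _.
exact: leeD2l.
Qed.

(** The conclusion is phrased with an exceptional event so that the deterministic estimate can be
    applied at each outcome outside it. *)
Lemma exists_good_event {n m : nat} (U U' : T -> m.-tuple R) (Us : 'I_n -> T -> m.-tuple R)
    (a e : R) : 0 <= a -> 0 <= e ->
  (forall s, measurable_fun setT (Us s)) ->
  (forall s t, s != t ->
    same_law P (fun w => (U w, U' w)) (fun w => (Us s w, Us t w))) ->
  (P [set w | (a < `|L_of P U U' w|)%R] <= e%:E)%E ->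
  exists2 B, measurable B /\ (P B <= ((n * n)%:R * e)%:E)%E &
    forall w, ~ B w -> forall s t, `|Lmx (tau_of P U U') (fun s => Us s w) s t| <= a.
Proof.
move=> a0 e0 mUs lUs He.
set tau := tau_of P U U'.
pose L (x y : m.-tuple R) := (Defs.edist x y ^+ 2 - tau ^+ 2) / tau ^+ 2.
pose S := [set z : m.-tuple R * m.-tuple R | a < `|L z.1 z.2|].
have mS : measurable S.
  apply: (@measurable_exceed _ _ _ (fun z => L z.1 z.2)).
  apply: measurable_funM => //; apply: measurable_funB => //; apply: measurable_funX.
  by apply: measurable_edist; [exact: measurable_fst|exact: measurable_snd].
pose A (i : 'I_n * 'I_n) := (fun w => (Us i.1 w, Us i.2 w)) @^-1` S.
have mA i : measurable (A i).
  by apply: measurable_fun_preimage => //; exact: measurable_fun_pair.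
exists (\big[setU/set0]_(i : 'I_n * 'I_n | i.1 != i.2) A i).
  split; first by apply: bigsetU_measurable => i _.
  apply: (le_trans (probability_bigsetU _ _ _ _)) => // .
  (* Diagonal pairs are counted too, at cost e each, to reach the round number n * n. *)
  apply: (@le_trans _ _ (\sum_(i : 'I_n * 'I_n) e%:E)%E).
    rewrite big_mkcond; apply: lee_sum => -[s t] _ /=; case: ifP => // st.
    by rewrite /A /= -(lUs _ _ st S mS).
  by rewrite sumEFin sumr_const card_prod card_ord mulr_natl.
move=> w nB s t; rewrite mxE; case: eqP => [_|/eqP st]; first by rewrite normr0.
rewrite leNgt; apply/negP => lt; apply: nB.
by rewrite (bigD1 (s, t)) //=; left.
Qed.

End distances.

(** * Stochastic orders *)

Lemma near2_ooP (Q : nat -> nat -> Prop) :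
  (\forall p \near \oo & q \near \oo, Q p q) <->
  exists N, forall p q, (N <= p)%N -> (N <= q)%N -> Q p q.
Proof.
split=> [[[A B] [[N1 _ HA] [N2 _ HB]] AB]|[N HN]].
  exists (maxn N1 N2) => p q; rewrite !geq_max => /andP[Np _] /andP[_ Nq].
  by apply: (AB (p, q)); split; [exact: HA|exact: HB].
exists ([set p | (N <= p)%N], [set q | (N <= q)%N]) => [|[p q] [/= Np Nq]].
  by split; exists N.
exact: HN.
Qed.

Lemma is_o1_lt {R : realType} (f : nat -> nat -> R) (e : R) : is_o1 f -> 0 < e ->
  exists N, forall p q, (N <= p)%N -> (N <= q)%N -> `|f p q| < e.
Proof.
move=> f0 e0; apply/near2_ooP.
have [[A B] [A0 B0] AB] := cvgr0_norm_lt _ f0 _ e0.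
exists (A, B) => //.
Qed.

Lemma cvgr0_oo_lt {R : realType} (f : nat -> R) (e : R) : f @ \oo --> (0 : R) -> 0 < e ->
  exists N, forall p, (N <= p)%N -> `|f p| < e.
Proof. by move=> f0 e0; have [N _ HN] := cvgr0_norm_lt _ f0 _ e0; exists N. Qed.

Section stochastic_orders.
Context {R : realType} {d : nat -> nat -> measure_display}
  {T : forall p q, measurableType (d p q)} (P : forall p q, probability (T p q) R).
Implicit Types (Z : forall p q, T p q -> R) (r : nat -> nat -> R).

Lemma is_Op_good_event Z r : (forall p q, measurable_fun setT (Z p q)) ->
  (forall e, 0 < e -> exists2 M, 0 < M & exists N, forall p q, (N <= p)%N -> (N <= q)%N ->
    exists2 B, measurable B /\ (P p q B <= e%:E)%E &
      forall w, ~ B w -> `|Z p q w| <= M * `|r p q|) ->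
  is_Op P Z r.
Proof.
move=> mZ H e /H[M M0 [N HN]]; exists M => //; apply/near2_ooP; exists N => p q Np Nq.
have [B [mB PB] HB] := HN p q Np Nq.
apply: le_trans PB; apply: le_measure; rewrite ?inE //; first exact: measurable_exceed.
by move=> w /= lt; apply: contrapT => /HB; rewrite leNgt lt.
Qed.

(** The smallness of r against r' is stated multiplicatively, so r' may vanish. *)
Lemma is_Op_is_op Z r r' : (forall p q, measurable_fun setT (Z p q)) ->
  is_Op P Z r ->
  (forall e, 0 < e -> exists N, forall p q, (N <= p)%N -> (N <= q)%N ->
    `|r p q| <= e * `|r' p q|) ->
  is_op P Z r'.
Proof.
move=> mZ ZO rr' e e0.
have Pfin (k : nat * nat) :
    P k.1 k.2 [set w | e * `|r' k.1 k.2| < `|Z k.1 k.2 w|] \is a fin_num.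
  exact: fin_num_measure (measurable_exceed _ _ (mZ _ _)).
apply/fine_cvgP; split; first by apply: nearW => k; exact: Pfin.
apply/cvgr0Pnorm_le => x x0.
have [M M0 /near2_ooP[N HN]] := ZO x x0.
(* With this choice M |r| <= e |r'|, so exceeding e |r'| entails exceeding M |r|. *)
have [N' HN'] := rr' (e / M) (divr_gt0 e0 M0).
have /near2_ooP : exists N, forall p q, (N <= p)%N -> (N <= q)%N ->
    `|fine (P p q [set w | e * `|r' p q| < `|Z p q w|])| <= x.
  exists (maxn N N') => p q; rewrite !geq_max => /andP[Np N'p] /andP[Nq N'q].
  rewrite ger0_norm ?fine_ge0 // -lee_fin fineK; last exact: (Pfin (p, q)).
  apply: le_trans (HN p q Np Nq).
  apply: le_measure; rewrite ?inE; [exact: measurable_exceed..|].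
  move=> w /=; apply: le_lt_trans.
  have := HN' p q N'p N'q.
  by rewrite mulrAC ler_pdivlMr // mulrC.
case=> [[A B] [A0 B0] AB]; exists (A, B) => //.
Qed.

End stochastic_orders.

Lemma Lfun2_coord {d : measure_display} {T : measurableType d} {R : realType}
    (P : probability T R) {m : nat} (U : {RV P >-> m.-tuple R}) (b : R) :
  (ereal_sup (range (fun i : 'I_m => 'E_P[(fun w => tnth (U w) i ^+ 2)%R])) <= b%:E)%E ->
  forall i, (fun w => tnth (U w) i) \in Lfun P 2%:E.
Proof.
move=> Ub i; apply: Lfun2P.
  exact: (measurableT_comp (measurable_tnth i) (measurable_funP U)).
apply: (@le_lt_trans _ _ b%:E); last exact: ltry.
by apply: le_trans Ub; apply: ereal_sup_ubound; exists i.
Qed.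

Theorem theorem2p1p1 (R : realType) (n : nat) (hn : (4 <= n)%N)
    (d : nat -> nat -> measure_display)
    (T : forall p q, measurableType (d p q))
    (P : forall p q, probability (T p q) R)
    (X X' : forall p q, {RV (P p q) >-> p.-tuple R})
    (Y Y' : forall p q, {RV (P p q) >-> q.-tuple R})
    (Xs : forall p q, 'I_n -> {RV (P p q) >-> p.-tuple R})
    (Ys : forall p q, 'I_n -> {RV (P p q) >-> q.-tuple R})
    (hcopy : forall p q, independent_copy (P p q)
       (fun w => (X p q w, Y p q w)) (fun w => (X' p q w, Y' p q w)))
    (hsample : forall p q, iid_copies (P p q)
       (fun w => (X p q w, Y p q w)) (fun s w => (Xs p q s w, Ys p q s w)))
    (a b a' b' : R) (ha : 0 < a) (ha' : 0 < a')
    (hX : forall p q,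
       (a%:E <= ereal_inf (range (fun i : 'I_p =>
                  'V_(P p q)[(fun w => tnth (X p q w) i)%R])))%E /\
       (ereal_sup (range (fun i : 'I_p =>
                  'E_(P p q)[(fun w => tnth (X p q w) i ^+ 2)%R])) <= b%:E)%E)
    (hY : forall p q,
       (a'%:E <= ereal_inf (range (fun j : 'I_q =>
                  'V_(P p q)[(fun w => tnth (Y p q w) j)%R])))%E /\
       (ereal_sup (range (fun j : 'I_q =>
                  'E_(P p q)[(fun w => tnth (Y p q w) j ^+ 2)%R])) <= b'%:E)%E) :
  let tauX p q := tau_of (P p q) (X p q) (X' p q) in
  let tauY p q := tau_of (P p q) (Y p q) (Y' p q) in
  let tau p q := tauX p q * tauY p q in
  let LX p q := L_of (P p q) (X p q) (X' p q) in
  let LY p q := L_of (P p q) (Y p q) (Y' p q) in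
  let dCovn p q w := dCov2 (fun s => Xs p q s w) (fun s => Ys p q s w) in
  let covn p q (i : 'I_p) (j : 'I_q) w :=
    cov2 (fun s => tnth (Xs p q s w) i) (fun s => tnth (Ys p q s w) j) in
  let lead p q w := (tau p q)^-1 * \sum_(i < p) \sum_(j < q) covn p q i j w in
  exists Rn : forall p q, T p q -> R,
    [/\ forall p q w, dCovn p q w = lead p q w + Rn p q w,
        forall p q (i : 'I_p) (j : 'I_q),
          ('E_(P p q)[covn p q i j] =
           covariance (P p q) (fun w => tnth (X p q w) i)
                                (fun w => tnth (Y p q w) j) ^+ 2)%E
      & forall ap bq : nat -> R,
          is_Op P LX (fun p _ => ap p) ->
          is_Op P LY (fun _ q => bq q) ->
          ap @ \oo --> (0 : R) ->
          bq @ \oo --> (0 : R) ->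
          is_o1 (fun p q => tauX p q ^+ 2 * ap p ^+ 3) ->
          is_o1 (fun p q => tauY p q ^+ 2 * bq q ^+ 3) ->
          is_o1 (fun p q => tau p q * ap p ^+ 2 * bq q) ->
          is_o1 (fun p q => tau p q * ap p * bq q ^+ 2) ->
          [/\ is_Op P lead (fun p q => tau p q * ap p * bq q),
              is_Op P Rn (fun p q => `|tau p q * ap p ^+ 2 * bq q|
                                     + `|tau p q * ap p * bq q ^+ 2|),
              is_op P Rn (fun _ _ => 1)
            & is_op P Rn (fun p q => tau p q * ap p * bq q)]].
Proof.
move=> tauX tauY tau LX LY dCovn covn lead.
(* The remainder is the difference itself, so the decomposition is immediate and its content lies in
   the bounds on [Rn]. *)
pose Rn p q w := dCovn p q w - lead p q w.
have mXY p q : measurable_fun setT (fun w => (X p q w, Y p q w)).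
  by apply: measurable_fun_pair.
have mXY' p q : measurable_fun setT (fun w => (X' p q w, Y' p q w)).
  by apply: measurable_fun_pair.
have mXYs p q s : measurable_fun setT (fun w => (Xs p q s w, Ys p q s w)).
  by apply: measurable_fun_pair.
have X2 p q := Lfun2_coord _ _ _ (hX p q).2.
have Y2 p q := Lfun2_coord _ _ _ (hY p q).2.
exists Rn; split.
- by move=> p q w; rewrite /Rn addrC subrK.
- move=> p q i j.
  apply: (@cov2_unbiased _ _ _ (P p q) _ _ n (fun w => (X p q w, Y p q w))
    (fun s w => (Xs p q s w, Ys p q s w)) (fun z => tnth z.1 i) (fun z => tnth z.2 j)) => //.
  + exact: (measurableT_comp (measurable_tnth i) measurable_fst).
  + exact: (measurableT_comp (measurable_tnth j) measurable_snd).
  + exact: X2.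
  + exact: Y2.
move=> ap bq OX OY a0 b0 _ _ o1 o2.
have mdCov p q : measurable_fun setT (dCovn p q).
  by apply: measurable_UdCov => s t; under eq_fun do rewrite mxE; exact: measurable_edist.
have mlead p q : measurable_fun setT (lead p q).
  apply: measurable_funM => //; under eq_fun do rewrite sum_cov2 //.
  apply: measurable_funM => //.
  apply: measurable_UdCov => s t; under eq_fun do rewrite mxE;
    by apply: measurable_funX; exact: measurable_edist.
have mRn p q : measurable_fun setT (Rn p q) by exact: measurable_funB.
have iXY p q : independent (P p q) (fun w => (X p q w, Y p q w)) (fun w => (X' p q w, Y' p q w)).
  move=> A B mA mB; exact: (hcopy p q).2.
have lXY p q : same_law (P p q) (fun w => (X p q w, Y p q w)) (fun w => (X' p q w, Y' p q w)).
  by move=> A mA; rewrite (hcopy p q).1.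
have iXYs p q s t : s != t -> independent (P p q) (fun w => (Xs p q s w, Ys p q s w))
    (fun w => (Xs p q t w, Ys p q t w)).
  move=> st.
  by apply: (mutually_independent2 _ (fun s w => (Xs p q s w, Ys p q s w)) _ _ st (hsample p q).1).
have lXYs p q s : same_law (P p q) (fun w => (X p q w, Y p q w))
    (fun w => (Xs p q s w, Ys p q s w)).
  by move=> A mA; rewrite (hsample p q).2.
have lXYs' p q s : same_law (P p q) (fun w => (X' p q w, Y' p q w))
    (fun w => (Xs p q s w, Ys p q s w)).
  by move=> A mA; rewrite -(lXY p q A mA); exact: lXYs.
have lX p q s t : s != t -> same_law (P p q) (fun w => (X p q w, X' p q w))
    (fun w => (Xs p q s w, Xs p q t w)).
  move=> st; apply: same_law_pair => //.
  - exact: (independent_comp _ _ _ _ _ measurable_fst measurable_fst (iXY p q)).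
  - exact: (independent_comp _ _ _ _ _ measurable_fst measurable_fst (iXYs p q s t st)).
  - exact: (same_law_comp _ _ _ _ measurable_fst (lXYs p q s)).
  - exact: (same_law_comp _ _ _ _ measurable_fst (lXYs' p q t)).
have lY p q s t : s != t -> same_law (P p q) (fun w => (Y p q w, Y' p q w))
    (fun w => (Ys p q s w, Ys p q t w)).
  move=> st; apply: same_law_pair => //.
  - exact: (independent_comp _ _ _ _ _ measurable_snd measurable_snd (iXY p q)).
  - exact: (independent_comp _ _ _ _ _ measurable_snd measurable_snd (iXYs p q s t st)).
  - exact: (same_law_comp _ _ _ _ measurable_snd (lXYs p q s)).
  - exact: (same_law_comp _ _ _ _ measurable_snd (lXYs' p q t)).
(* For p = 0 the distance is an empty sum and tauX is 0; this is why the threshold chosen in [key]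
   is at least 1. *)
have tX0 p q : (0 < p)%N -> 0 < tauX p q.
  move=> p0; apply: (@tau_of_gt0 _ _ _ _ _ _ _ (Ordinal p0)) => //.
  - exact: (same_law_comp _ _ _ _ measurable_fst (lXY p q)).
  - exact: (independent_comp _ _ _ _ _ measurable_fst measurable_fst (iXY p q)).
  - exact: X2.
  - apply: (@lt_le_trans _ _ a%:E); first by rewrite lte_fin.
    apply: (le_trans (hX p q).1); apply: ereal_inf_lbound.
    by exists (Ordinal p0).
have tY0 p q : (0 < q)%N -> 0 < tauY p q.
  move=> q0; apply: (@tau_of_gt0 _ _ _ _ _ _ _ (Ordinal q0)) => //.
  - exact: (same_law_comp _ _ _ _ measurable_snd (lXY p q)).
  - exact: (independent_comp _ _ _ _ _ measurable_snd measurable_snd (iXY p q)).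
  - exact: Y2.
  - apply: (@lt_le_trans _ _ a'%:E); first by rewrite lte_fin.
    apply: (le_trans (hY p q).1); apply: ereal_inf_lbound.
    by exists (Ordinal q0).
have [K K0 HK] := @dCov2_bound R n hn.
(* One event controls both statistics; all stochastic orders below are read off from it. *)
have key e : 0 < e -> exists M1 M2, [/\ 0 < M1, 0 < M2 & exists N, forall p q,
    (N <= p)%N -> (N <= q)%N ->
    exists2 B, measurable B /\ (P p q B <= e%:E)%E & forall w, ~ B w ->
      `|lead p q w| <= K * (tau p q * (M1 * `|ap p|) * (M2 * `|bq q|)) /\
      `|Rn p q w| <= K * (tau p q * ((M1 * `|ap p|) ^+ 2 * (M2 * `|bq q|)
         + (M1 * `|ap p|) * (M2 * `|bq q|) ^+ 2
         + (M1 * `|ap p|) ^+ 2 * (M2 * `|bq q|) ^+ 2))].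
  (* The union bound costs n * n for the X sample and as much for the Y sample. *)
  move=> e0; pose e' := e / (2 * (n * n)%:R).
  have nn0 : 0 < (n * n)%:R :> R by rewrite ltr0n muln_gt0 andbb (leq_trans _ hn).
  have e'0 : 0 < e' by rewrite divr_gt0 // mulr_gt0.
  have [M1 M10 /near2_ooP[N1 H1]] := OX e' e'0.
  have [M2 M20 /near2_ooP[N2 H2]] := OY e' e'0.
  exists M1, M2; split=> //; exists (maxn 1 (maxn N1 N2)) => p q.
  rewrite !geq_max => /and3P[p0 N1p N2p] /and3P[q0 N1q N2q].
  have al0 : 0 <= M1 * `|ap p| by rewrite mulr_ge0 // ltW.
  have be0 : 0 <= M2 * `|bq q| by rewrite mulr_ge0 // ltW.
  have [B1 [mB1 PB1] HB1] := exists_good_event (P p q) _ _ (Xs p q) _ _ al0 (ltW e'0)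
    (fun s => measurable_funP (Xs p q s)) (lX p q) (H1 p q N1p N1q).
  have [B2 [mB2 PB2] HB2] := exists_good_event (P p q) _ _ (Ys p q) _ _ be0 (ltW e'0)
    (fun s => measurable_funP (Ys p q s)) (lY p q) (H2 p q N2p N2q).
  exists (B1 `|` B2).
    split; first exact: measurableU.
    apply: le_trans (measureU2 _ mB1 mB2) _.
    apply: le_trans (leeD PB1 PB2) _.
    rewrite -EFinD lee_fin /e'; move: nn0; move: (n * n)%:R => k k0.
    by rewrite le_eqVlt; apply/orP; left; apply/eqP; field; rewrite gt_eqF.
  move=> w /not_orP[/HB1 L1 /HB2 L2].
  exact: (HK _ _ (tX0 p q p0) (tY0 p q q0) _ _ _ _ _ _ al0 be0 L1 L2).
have t0 p q : 0 <= tau p q by rewrite mulr_ge0 // sqrtr_ge0.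
have norm_tau p q x y : `|tau p q * x * y| = tau p q * `|x| * `|y|.
  by rewrite normrM [`|tau p q * x|]normrM ger0_norm.
have RnO : is_Op P Rn (fun p q => `|tau p q * ap p ^+ 2 * bq q|
                                  + `|tau p q * ap p * bq q ^+ 2|).
  apply: is_Op_good_event => // e /key[M1 [M2 [M10 M20 [N HN]]]].
  (* From |b_q| < 1 on, the rate a_p^2 b_q^2 is dominated by a_p^2 b_q. *)
  have [N' HN'] := cvgr0_oo_lt _ _ b0 ltr01.
  exists (K * (M1 ^+ 2 * M2 + M1 * M2 ^+ 2 + M1 ^+ 2 * M2 ^+ 2)).
    by rewrite mulr_gt0 // !addr_gt0 // mulr_gt0 // exprn_gt0.
  exists (maxn N N') => p q; rewrite !geq_max => /andP[Np _] /andP[Nq N'q].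
  have [B HB HBw] := HN p q Np Nq; exists B => // w /HBw[_] /le_trans; apply.
  rewrite -(mulrA K) ler_wpM2l ?(ltW K0) //.
  rewrite [in leRHS]ger0_norm ?addr_ge0 //.
  rewrite !norm_tau !normrX.
  have bq1 := ltW (HN' q N'q).
  move: (t0 p q) (normr_ge0 (ap p)) (normr_ge0 (bq q)) bq1.
  move: (tau p q) `|ap p| `|bq q| => t x y t00 x0 y0 y1.
  rewrite -subr_ge0.
  (* The difference of the two sides is displayed as a sum of nonnegative terms; only 1 - y needs
     the bound on b_q. *)
  rewrite (_ : _ - _ = M1 ^+ 2 * M2 * (t * x * y ^+ 2) + M1 * M2 ^+ 2 * (t * x ^+ 2 * y)
    + M1 ^+ 2 * M2 ^+ 2 * (t * x ^+ 2 * y * (1 - y) + t * x * y ^+ 2)); last by ring.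
  have := ltW M10; have := ltW M20; move: y1; rewrite -subr_ge0 => y1 m1 m2.
  by rewrite !addr_ge0 // !mulr_ge0 // ?addr_ge0 // ?mulr_ge0 //
    ?exprn_ge0 // ?mulr_ge0 // exprn_ge0.
split=> //.
- apply: is_Op_good_event => // e /key[M1 [M2 [M10 M20 [N HN]]]].
  exists (K * (M1 * M2)); first by rewrite !mulr_gt0.
  exists N => p q Np Nq.
  have [B HB HBw] := HN p q Np Nq; exists B => // w /HBw[+ _] => /le_trans; apply.
  rewrite norm_tau le_eqVlt; apply/orP; left; apply/eqP; ring.
- apply: is_Op_is_op RnO _ => // e e0.
  have e20 : 0 < e / 2 by rewrite divr_gt0.
  have [N1 H1] := is_o1_lt _ _ o1 e20; have [N2 H2] := is_o1_lt _ _ o2 e20.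
  exists (maxn N1 N2) => p q; rewrite !geq_max => /andP[N1p N2p] /andP[N1q N2q].
  rewrite normr1 mulr1 ger0_norm ?addr_ge0 //.
  have := H1 p q N1p N1q; have := H2 p q N2p N2q; lra.
(* The remainder rate is exactly |a_p| + |b_q| times the leading rate, and this factor tends to
   0. *)
- apply: is_Op_is_op RnO _ => // e e0.
  have e20 : 0 < e / 2 by rewrite divr_gt0.
  have [N1 H1] := cvgr0_oo_lt _ _ a0 e20; have [N2 H2] := cvgr0_oo_lt _ _ b0 e20.
  exists (maxn N1 N2) => p q; rewrite !geq_max => /andP[N1p _] /andP[_ N2q].
  rewrite ger0_norm ?addr_ge0 //.
  have -> : `|tau p q * ap p ^+ 2 * bq q| + `|tau p q * ap p * bq q ^+ 2| =
      (`|ap p| + `|bq q|) * `|tau p q * ap p * bq q|.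
    by rewrite !norm_tau !normrX; ring.
  rewrite ler_wpM2r //; have := H1 p N1p; have := H2 q N2q; lra.
Qed.
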